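(* Let $k\ge0$ be an integer. In $\bigwedge^k\Omega^1(G)\otimes_{\mathbb R}\bigwedge^k\Omega^1(G)$, the following equality holds: $$\sum_{F\in\mathcal F_k(G)}\underline x^F(\det\mathscr B^F)^{\otimes2}=T(\underline x)\sum_{S\subseteq E^+,\,|S|=k}(\Pi^{\operatorname{im} d})^{\wedge k}\Big(\frac{e^\star_S}{\sqrt{\underline x^S}}\Big)\otimes\frac{e^\star_S}{\sqrt{\underline x^S}},$$ where $T(\underline x)=\sum_{T\in\mathcal T(G)}\underline x^T$.
   Context: Let $\mathbb K=\mathbb R$ or $\mathbb C$. $G=(V,E)$ is a finite connected graph: $V$ is a finite set of vertices and $E$ a finite set of oriented edges, with source and target maps $s,t:E\to V$ and a fixed-point-free involution $e\mapsto e^{-1}$ of $E$ exchanging source and target. $E^+\subset E$ is a fixed subset containing exactly one element of each pair $\{e,e^{-1}\}$, with a fixed total order. Positive weights $\underline x=(x_e)_{e\in E}$ with $x_{e^{-1}}=x_e$ are given, and $\underline x^A=\prod_{e\in (A\cup A^{-1})\cap E^+}x_e$ for $A\subseteq E$. A subgraph is a subset $S\subseteq E$ stable under $e\mapsto e^{-1}$, seen as the graph $(V,S)$. $\mathcal T(G)$ is the set of spanning trees; $\mathcal F_k(G)$ is the set of acyclic (spanning) subgraphs with $k+1$ connected components. $C_1(G)$ is the free abelian group on $E$ modulo $e+e^{-1}=0$; $C^1(G)=\mathrm{Hom}(C_1(G),\mathbb Z)$, with basis $(e^\star)_{e\in E^+}$ dual to $E^+$. $\delta$ sends $f:V\to\mathbb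 Z$ to $\delta f\in C^1(G)$, $\delta f(e)=f(t(e))-f(s(e))$; $B^1(G)=\operatorname{im}\delta$; $B^1(G,F)$ is the subgroup of elements of $B^1(G)$ vanishing on the edges of $F$. For $F\in\mathcal F_k(G)$, $\mathscr B^F=(\beta_1,\dots,\beta_k)$ is any $\mathbb Z$-basis of $B^1(G,F)$ and $\det\mathscr B^F=\beta_1\wedge\dots\wedge\beta_k$ (well defined up to sign, so that its tensor square is well defined), seen in $\bigwedge^k\Omega^1(G)$. $\Omega^1(G)=C^1(G)\otimes\mathbb K$ has inner product $\langle\alpha,\beta\rangle=\sum_{e\in E^+}x_e\overline{\alpha(e)}\beta(e)$; $d=\delta\otimes\mathrm{id}_{\mathbb K}:\mathbb K^V\to\Omega^1(G)$; $\Pi^{\operatorname{im} d}$ is the orthogonal projection on $\operatorname{im} d$. $a^{\wedge k}$ is the map induced by $a$ on $k$-th exterior powers (over $\mathbb K$). For $S=\{e_1<\dots<e_k\}\subseteq E^+$, $e^\star_S=e^\star_1\wedge\dots\wedge e^\star_k$. The outer tensor product is over $\mathbb R$ even if $\mathbb K=\mathbb C$, and $u^{\otimes2}=u\otimes u$. *)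

(* Defs.v *)
From HB Require Import structures.
From mathcomp Require Import all_boot all_order all_algebra.
From mathcomp Require Import boolp classical_sets reals.
From mathcomp Require Import ring.
From mathcomp.multinomials Require freeg.
From mathcomp.real_closed Require Import complex.

Set Implicit Arguments.
Unset Strict Implicit.
Unset Printing Implicit Defensive.

Import Order.TTheory GRing.Theory Num.Theory.
Local Open Scope ring_scope.
Local Open Scope quotient_scope.

(* MathComp has neither exterior powers nor tensor products of modules.  Both
   are obtained here as modules given by generators and relations: for a type
   X of generators and a predicate rel on the free module on X, [presented rel]
   is the quotient of the free module by the submodule spanned by rel. *)
Section Presented.
Import freeg.
Variables (R : comNzRingType) (X : choiceType).
Local Notation free := {freeg X / R}.

Definition free_gen (v : X) : free := Freeg [:: (1, v)].

Definition rel_span (rel : free -> Prop) : pred free := fun z =>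
  `[< exists s : seq (R * free),
        (forall p, p \in s -> rel p.2) /\ z = \sum_(p <- s) p.1 *: p.2 >].

Lemma rel_span_closed rel : submod_closed (rel_span rel).
Proof.
split; first by apply/asboolP; exists [::]; rewrite big_nil.
move=> a _ _ /asboolP[s [hs ->]] /asboolP[t [ht ->]]; apply/asboolP.
exists ([seq (a * p.1, p.2) | p <- s] ++ t); split.
  move=> p; rewrite mem_cat => /orP[/mapP[q qs ->] /=|/ht//]; exact: hs.
by rewrite big_cat big_map scaler_sumr; congr (_ + _); apply: eq_bigr => p _;
   rewrite scalerA.
Qed.

HB.instance Definition _ rel :=
  GRing.isSubmodClosed.Build R free (rel_span rel) (rel_span_closed rel).

Definition presented (rel : free -> Prop) : Type :=
  Quotient.quot (GRing.ZmodClosed.clone _ (rel_span rel) _).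

HB.instance Definition _ rel := GRing.Zmodule.on (presented rel).
HB.instance Definition _ rel := EqQuotient.on (presented rel).

Section Instances.
Variable rel : free -> Prop.
Local Notation Q := (presented rel).

Lemma presented_eqP (x y : free) :
  reflect (\pi_Q x = \pi_Q y) (rel_span rel (x - y)).
Proof.
have -> : rel_span rel (x - y) = (x == y %[mod Q]).
  exact: (Quotient.idealrBE (GRing.ZmodClosed.clone _ (rel_span rel) _) x y).
exact: eqP.
Qed.

Lemma presentedW (q : Q) : exists x : free, q = \pi_Q x.
Proof. by exists (repr q); rewrite reprK. Qed.

Lemma presented_piB : zmod_morphism (\pi_Q : free -> Q).
Proof. exact: (@pi_is_zmod_morphism free). Qed.

Definition presented_scale (a : R) (q : Q) : Q := \pi_Q (a *: repr q : free).

Lemma presented_scale_pi a x : presented_scale a (\pi_Q x) = \pi_Q (a *: x : free).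
Proof.
apply/presented_eqP; rewrite -scalerBr.
by apply: (rpredZ a (_ : repr _ - x \in rel_span rel)); apply/presented_eqP;
   rewrite reprK.
Qed.

Lemma presented_scaleA a b q :
  presented_scale a (presented_scale b q) = presented_scale (a * b) q.
Proof. by case: (presentedW q) => x ->; rewrite !presented_scale_pi scalerA. Qed.

Lemma presented_scale1 : left_id 1 presented_scale.
Proof. by move=> q; case: (presentedW q) => x ->; rewrite presented_scale_pi scale1r. Qed.

Lemma presented_piD x y : \pi_Q (x + y) = (\pi_Q x + \pi_Q y : Q).
Proof.
have := presented_piB (x + y) y; rewrite addrK => /eqP.
by rewrite eq_sym subr_eq => /eqP.
Qed.

Lemma presented_pi0 : \pi_Q 0 = 0.
Proof. by have := presented_piB 0 0; rewrite !subrr. Qed.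

Lemma presented_scaleDr : right_distributive presented_scale +%R.
Proof.
move=> a p q; case: (presentedW p) => x ->; case: (presentedW q) => y ->.
by rewrite -presented_piD !presented_scale_pi scalerDr presented_piD.
Qed.

Lemma presented_scaleDl q :
  {morph (presented_scale^~ q) : a b / a + b}.
Proof.
case: (presentedW q) => x -> a b.
by rewrite !presented_scale_pi scalerDl presented_piD.
Qed.
End Instances.

HB.instance Definition _ rel := GRing.Zmodule_isLmodule.Build R (presented rel)
  (@presented_scaleA rel) (@presented_scale1 rel) (@presented_scaleDr rel)
  (@presented_scaleDl rel).

Definition pgen (rel : free -> Prop) (v : X) : presented rel :=
  \pi_(presented rel) (free_gen v).

Section Universal.
Variables (rel : free -> Prop) (M : lmodType R) (f : X -> M).
Local Notation Q := (presented rel).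

(* Total, but meaningful only when f respects the relations. *)
Definition plift (q : Q) : M := fglift f (repr q).

Hypothesis f_rel : forall z, rel z -> fglift f z = 0.

Lemma fgliftB x y : fglift f (x - y) = fglift f x - fglift f y.
Proof. exact: lift_is_additive. Qed.

Lemma fgliftD x y : fglift f (x + y) = fglift f x + fglift f y.
Proof. by have /eqP := fgliftB (x + y) y; rewrite addrK eq_sym subr_eq => /eqP. Qed.

Lemma fglift_gen a v : fglift f (a *: free_gen v) = a *: f v.
Proof.
suff -> : a *: free_gen v = Freeg [:: (a, v)] by rewrite liftU.
by apply/eqP/freeg_eqP => w; rewrite coeffZ !coeffU mul1r.
Qed.

Lemma freeE z : z = \sum_(v <- dom z) coeff v z *: free_gen v.
Proof.
rewrite -{1}[z]freeg_sumE; apply: eq_bigr => v _.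
by apply/eqP/freeg_eqP => w; rewrite coeffZ !coeffU mul1r.
Qed.

Lemma fglift_sum I (s : seq I) (F : I -> free) :
  fglift f (\sum_(i <- s) F i) = \sum_(i <- s) fglift f (F i).
Proof.
apply: (big_morph (fglift f) fgliftD).
by have := fgliftB 0 0; rewrite !subrr.
Qed.

Lemma fgliftZ a x : fglift f (a *: x) = a *: fglift f x.
Proof.
rewrite (freeE x) scaler_sumr !fglift_sum scaler_sumr; apply: eq_bigr => v _.
by rewrite scalerA !fglift_gen scalerA.
Qed.

Lemma plift_pi x : plift (\pi x) = fglift f x.
Proof.
apply/eqP; rewrite -subr_eq0 -fgliftB; apply/eqP.
have /presented_eqP/asboolP[s [hs ->]] : \pi_Q (repr (\pi_Q x)) = \pi_Q x.
  by rewrite reprK.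
rewrite fglift_sum big_seq big1 // => p ps.
by rewrite fgliftZ f_rel ?scaler0//; apply: hs.
Qed.

Lemma plift_gen v : plift (pgen rel v) = f v.
Proof. by rewrite plift_pi -[free_gen v]scale1r fglift_gen scale1r. Qed.

Lemma plift_linear : linear plift.
Proof.
move=> a p q; case: (presentedW p) => x ->; case: (presentedW q) => y ->.
rewrite (_ : a *: \pi_Q x + \pi_Q y = \pi_Q (a *: x + y)); last first.
  by rewrite presented_piD -presented_scale_pi.
by rewrite !plift_pi fgliftD fgliftZ.
Qed.

Lemma plift_unique (g : {linear Q -> M}) :
  (forall v, g (pgen rel v) = f v) -> g =1 plift.
Proof.
move=> gf q; case: (presentedW q) => x ->; rewrite plift_pi (freeE x) fglift_sum.
rewrite (big_morph _ (@presented_piD rel) (presented_pi0 rel)).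
rewrite (raddf_sum g); apply: eq_bigr => v _.
rewrite fglift_gen -gf -linearZ_LR; congr (g _).
exact: esym (presented_scale_pi _ _ _).
Qed.
End Universal.

Lemma pgen_rel (rel : free -> Prop) z : rel z -> \pi_(presented rel) z = 0.
Proof.
move=> rz; rewrite -[RHS](presented_pi0 rel).
apply/presented_eqP; rewrite subr0; apply/asboolP.
by exists [:: (1, z)]; split=> [p|]; rewrite ?inE ?big_seq1 ?scale1r// => /eqP->.
Qed.
End Presented.

Section ExteriorPower.
Import freeg.

Lemma fglift_rel (R : comNzRingType) (X : choiceType) (M : lmodType R)
    (f : X -> M) (a : R) (u v w : X) :
  fglift f (free_gen R u - a *: free_gen R v - free_gen R w)
  = f u - a *: f v - f w.
Proof.
rewrite !fgliftB fgliftZ -[free_gen R u]scale1r -[free_gen R w]scale1r.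
by rewrite -[free_gen R v]scale1r !fglift_gen !scale1r.
Qed.

Variables (K : comNzRingType) (k : nat).

Definition fset_at (U : Type) (v : {ffun 'I_k -> U}) (i : 'I_k) (u : U) :
  {ffun 'I_k -> U} := [ffun j => if j == i then u else v j].

Variant ext_rel (U : lmodType K) :
    {freeg {ffun 'I_k -> U} / K} -> Prop :=
| ExtLinear (v : {ffun 'I_k -> U}) (i : 'I_k) (a : K) (u w : U) :
    ext_rel (free_gen K (fset_at v i (a *: u + w))
             - a *: free_gen K (fset_at v i u) - free_gen K (fset_at v i w))
| ExtAlternate (v : {ffun 'I_k -> U}) (i j : 'I_k) :
    i != j -> v i = v j -> ext_rel (free_gen K v).

Definition ext_pow (U : lmodType K) : lmodType K := presented (@ext_rel U).

Definition wedge (U : lmodType K) (v : {ffun 'I_k -> U}) : ext_pow U :=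
  pgen (@ext_rel U) v.

Lemma wedge_linear (V : lmodType K) (v : {ffun 'I_k -> V}) i c (u w : V) :
  wedge (fset_at v i (c *: u + w))
  = c *: wedge (fset_at v i u) + wedge (fset_at v i w).
Proof.
apply/eqP; rewrite -subr_eq0 opprD addrA; apply/eqP.
have := pgen_rel (ExtLinear v i c u w).
by rewrite !presented_piB -presented_scale_pi.
Qed.

Lemma wedge_alt (V : lmodType K) (v : {ffun 'I_k -> V}) i j :
  i != j -> v i = v j -> wedge v = 0.
Proof. by move=> ij vij; apply: pgen_rel; apply: ExtAlternate ij vij. Qed.
Definition ext_map (U V : lmodType K) (a : {linear U -> V}) :
    ext_pow U -> ext_pow V :=
  plift (fun u : {ffun 'I_k -> U} => wedge [ffun i => a (u i)]).

Lemma ext_map_rel (U V : lmodType K) (a : {linear U -> V}) z : ext_rel z ->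
  fglift (fun u : {ffun 'I_k -> U} => wedge [ffun i => a (u i)]) z = 0.
Proof.
have fE (v : {ffun 'I_k -> U}) i u :
    [ffun j => a (fset_at v i u j)] = fset_at [ffun j => a (v j)] i (a u).
  by apply/ffunP => j; rewrite !ffunE; case: ifP.
case=> [v i c u w|v i j ij vij].
  rewrite fglift_rel !fE linearP wedge_linear.
  by rewrite -addrA -opprD subrr.
rewrite -[free_gen K v]scale1r fglift_gen scale1r.
by apply: wedge_alt ij _; rewrite !ffunE vij.
Qed.

Lemma ext_map_wedge (U V : lmodType K) (a : {linear U -> V}) v :
  ext_map a (wedge v) = wedge [ffun i => a (v i)].
Proof. by rewrite /ext_map plift_gen//; apply: ext_map_rel. Qed.

HB.instance Definition _ (U V : lmodType K) (a : {linear U -> V}) :=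
  GRing.isLinear.Build K (ext_pow U) (ext_pow V) _ (ext_map a)
    (plift_linear (@ext_map_rel U V a)).
End ExteriorPower.

(* U \otimes_R W for modules U, W over a ring K, seen as R-modules by
   restriction of scalars along iota : R -> K. *)
Section Tensor.
Import freeg.
Variables (R K : comNzRingType) (iota : {rmorphism R -> K}) (U W : lmodType K).

Variant tens_rel : {freeg (U * W)%type / R} -> Prop :=
| TensLinearL (a : R) (u u' : U) (w : W) :
    tens_rel (free_gen R (iota a *: u + u', w)
              - a *: free_gen R (u, w) - free_gen R (u', w))
| TensLinearR (a : R) (u : U) (w w' : W) :
    tens_rel (free_gen R (u, iota a *: w + w')
              - a *: free_gen R (u, w) - free_gen R (u, w')).

Definition tensor : lmodType R := presented tens_rel.

Definition tens (u : U) (w : W) : tensor := pgen tens_rel (u, w).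

Lemma tens_linearl a u u' w :
  tens (iota a *: u + u') w = a *: tens u w + tens u' w.
Proof.
apply/eqP; rewrite -subr_eq0 opprD addrA; apply/eqP.
have := pgen_rel (TensLinearL a u u' w).
by rewrite !presented_piB -presented_scale_pi.
Qed.

Lemma tens_linearr a u w w' :
  tens u (iota a *: w + w') = a *: tens u w + tens u w'.
Proof.
apply/eqP; rewrite -subr_eq0 opprD addrA; apply/eqP.
have := pgen_rel (TensLinearR a u w w').
by rewrite !presented_piB -presented_scale_pi.
Qed.
End Tensor.

Variant scalar_field := RealScalars | ComplexScalars.

Section Scalars.
Variables (R : realType).

Definition scalars (s : scalar_field) : numFieldType :=
  match s with RealScalars => R | ComplexScalars => R[i] end.

Definition of_real (s : scalar_field) : {rmorphism R -> scalars s} :=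
  match s return {rmorphism R -> scalars s} with
  | RealScalars => idfun
  | ComplexScalars => real_complex R
  end.

Definition conjs (s : scalar_field) : {rmorphism scalars s -> scalars s} :=
  match s return {rmorphism scalars s -> scalars s} with
  | RealScalars => idfun
  | ComplexScalars => @conjc R
  end.

Lemma conjsK s : involutive (conjs s).
Proof. by case: s => // z; apply: conjcK. Qed.

Lemma conjs_mul_ge0 s (z : scalars s) : 0 <= conjs s z * z.
Proof.
case: s z => [z|[a b]]; first by rewrite /= -expr2 sqr_ge0.
by rewrite lecE /= !mulNr opprK -!expr2 addr_ge0 ?sqr_ge0// mulrC subrr eqxx.
Qed.

Lemma conjs_of_real s a : conjs s (of_real s a) = of_real s a.
Proof. by case: s => //=; apply: conjc_real. Qed.

Lemma of_real_gt0 s (a : R) : (0 < of_real s a) = (0 < a).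
Proof. by case: s => //; rewrite ltcE /= eqxx. Qed.
End Scalars.
Arguments of_real {R} s.
Arguments conjs {R} s.

(* A finite graph with an orientation pos (the set $E^+$) and a total order on
   pos.  Loops and multiple edges are allowed. *)
Record graph := Graph {
  vertex : finType;
  edge : finType;
  src : edge -> vertex;
  tgt : edge -> vertex;
  einv : edge -> edge;
  einvK : involutive einv;
  einv_neq : forall e, einv e != e;
  src_einv : forall e, src (einv e) = tgt e;
  tgt_einv : forall e, tgt (einv e) = src e;
  pos : {set edge};
  pos_einv : forall e, (einv e \in pos) = (e \notin pos);
  le_pos : rel edge;
  le_pos_total : {in pos &, total le_pos};
  le_pos_anti : {in pos &, antisymmetric le_pos};
  le_pos_trans : {in pos & &, transitive le_pos}
}.

Section Graph.
Variable G : graph.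
Implicit Types (S F T : {set edge G}) (k : nat).

(* A subgraph is an edge set stable under inversion, seen as a graph on all
   the vertices. *)
Definition subgraph S := [forall e in S, einv e \in S].

Definition adj S : rel (vertex G) :=
  fun u v => [exists e in S, (src e == u) && (tgt e == v)].

Definition components S : nat := n_comp (adj S) predT.

Definition connected S : bool := components S == 1%N.

(* A cycle is a nonempty closed path without backtracking going through
   pairwise distinct vertices: loops give cycles of length 1 and parallel
   edges cycles of length 2. *)
Definition graph_cycle (c : seq (edge G)) : bool :=
  [&& c != [::],
      cycle (fun e f => (tgt e == src f) && (f != einv e)) c
    & uniq [seq src e | e <- c]].

Definition acyclic S : bool :=
  `[< forall c : seq (edge G), {subset c <= S} -> ~~ graph_cycle c >].

Definition spanning_trees : {set {set edge G}} :=
  [set T | [&& subgraph T, acyclic T & connected T]].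

Definition spanning_forests k : {set {set edge G}} :=
  [set F | [&& subgraph F, acyclic F & components F == k.+1]].
End Graph.

(* Hom(C_1(G), A), where C_1(G) is the abelian group generated by the edges
   subject to e + e^-1 = 0. *)
Section Cochain.
Variable G : graph.

Definition antisymmetric_fun (A : zmodType) : pred {ffun edge G -> A} :=
  fun f => [forall e, f (einv e) == - f e].

Lemma antisymmetric_funP (A : zmodType) (f : {ffun edge G -> A}) :
  reflect (forall e, f (einv e) = - f e) (antisymmetric_fun f).
Proof. exact: 'forall_eqP. Qed.

Lemma antisymmetric_fun_zmod (A : zmodType) : zmod_closed (@antisymmetric_fun A).
Proof.
split=> [|f g /antisymmetric_funP fP /antisymmetric_funP gP];
  apply/antisymmetric_funP => e; rewrite !ffunE ?oppr0//.
by rewrite fP gP opprD.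
Qed.

HB.instance Definition _ (A : zmodType) :=
  GRing.isZmodClosed.Build {ffun edge G -> A} (@antisymmetric_fun A)
    (@antisymmetric_fun_zmod A).

Record cochain (A : zmodType) := Cochain {
  cochain_val :> {ffun edge G -> A};
  cochainP : antisymmetric_fun cochain_val
}.

HB.instance Definition _ (A : zmodType) := [isSub for @cochain_val A].
HB.instance Definition _ (A : zmodType) := [Choice of cochain A by <:].
HB.instance Definition _ (A : zmodType) :=
  [SubChoice_isSubZmodule of cochain A by <:].

Lemma antisymmetric_fun_scale (K : nzRingType) (A : lmodType K) :
  GRing.scaler_closed (@antisymmetric_fun A).
Proof.
move=> a f /antisymmetric_funP fP; apply/antisymmetric_funP => e.
by rewrite !ffunE fP scalerN.
Qed.

HB.instance Definition _ (K : nzRingType) (A : lmodType K) :=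
  GRing.isScaleClosed.Build K {ffun edge G -> A} (@antisymmetric_fun A)
    (@antisymmetric_fun_scale K A).
HB.instance Definition _ (K : nzRingType) (A : lmodType K) :=
  [SubZmodule_isSubLmodule of cochain A by <:].
End Cochain.

Section Coboundary.
Variable G : graph.

Lemma coboundary_subproof (A : zmodType) (f : {ffun vertex G -> A}) :
  antisymmetric_fun [ffun e : edge G => f (tgt e) - f (src e)].
Proof.
by apply/antisymmetric_funP => e; rewrite !ffunE src_einv tgt_einv opprB.
Qed.

Definition coboundary (A : zmodType) (f : {ffun vertex G -> A}) : cochain G A :=
  Cochain (coboundary_subproof f).

Definition int_cochain := cochain G int.

Definition B1 (b : int_cochain) : Prop := exists f : {ffun vertex G -> int},
  b = coboundary f.

Definition B1_rel (F : {set edge G}) (b : int_cochain) : Prop :=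
  B1 b /\ forall e, e \in F -> b e = 0.

Definition Zbasis k (H : int_cochain -> Prop)
    (B : {ffun 'I_k -> int_cochain}) : Prop :=
  (forall i, H (B i)) /\
  (forall b, H b -> exists! c : {ffun 'I_k -> int}, b = \sum_i B i *~ c i).

Lemma estar_subproof (e : edge G) :
  antisymmetric_fun [ffun f => (f == e)%:Z - (f == einv e)%:Z].
Proof.
apply/antisymmetric_funP => f; rewrite !ffunE opprB.
rewrite (inj_eq (inv_inj (@einvK G))) (inv_eq (@einvK G)).
by [].
Qed.

Definition estar (e : edge G) : int_cochain := Cochain (estar_subproof e).
End Coboundary.

Record weights (R : realType) (G : graph) := Weights {
  weight :> edge G -> R;
  weight_gt0 : forall e, 0 < weight e;
  weight_einv : forall e, weight (einv e) = weight e
}.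

Section Omega.
Variables (R : realType) (s : scalar_field) (G : graph).
Local Notation K := (scalars R s).

Definition Omega1 : lmodType K := cochain G K^o.

Lemma of_int_subproof (b : int_cochain G) :
  antisymmetric_fun [ffun e => (b e)%:~R : K^o].
Proof.
apply/antisymmetric_funP => e; rewrite !ffunE.
by rewrite (antisymmetric_funP _ (cochainP b)) mulrNz.
Qed.

(* the natural map from C^1(G) to C^1(G) \otimes K *)
Definition of_int_cochain (b : int_cochain G) : Omega1 :=
  Cochain (of_int_subproof b).

Definition wedge_basis k (B : {ffun 'I_k -> int_cochain G}) :
    ext_pow k Omega1 :=
  wedge [ffun i => of_int_cochain (B i)].

(* The default value of nth is never reached when S has k elements. *)
Definition estar_wedge k (S : {set edge G}) : ext_pow k Omega1 :=
  wedge_basis [ffun i : 'I_k =>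
         nth 0 [seq estar e | e <- sort (@le_pos G) (enum S)] i].

Variable x : weights R G.

Definition weight_prod (A : {set edge G}) : R :=
  \prod_(e in (A :|: @einv G @: A) :&: pos G) x e.

Definition tree_sum : R := \sum_(T in spanning_trees G) weight_prod T.

Definition estar_normalized k (S : {set edge G}) : ext_pow k Omega1 :=
  (of_real s (Num.sqrt (weight_prod S)))^-1 *: estar_wedge k S.

Definition inner (a b : Omega1) : K :=
  \sum_(e in pos G) of_real s (x e) * (conjs s (a e) * b e).

Definition differential (f : {ffun vertex G -> K}) : Omega1 :=
  coboundary (f : {ffun vertex G -> K^o}).

Definition orth_proj (W : set Omega1) (w : Omega1) : Omega1 :=
  xget 0 [set p | W p /\ forall u, W u -> inner u (w - p) = 0].

Definition proj_im_d : Omega1 -> Omega1 := orth_proj (range differential).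

Lemma cochainE (a : K) (u v : Omega1) e :
  (a *: u + v) e = a * u e + v e.
Proof. by rewrite !ffunE. Qed.

Lemma innerPr a u v w : inner u (a *: v + w) = a * inner u v + inner u w.
Proof.
rewrite /inner mulr_sumr -big_split; apply: eq_bigr => e _ /=.
rewrite cochainE.
ring.
Qed.

Lemma innerC u v : conjs s (inner u v) = inner v u.
Proof.
rewrite /inner rmorph_sum; apply: eq_bigr => e _.
rewrite !rmorphM /= conjsK conjs_of_real; ring.
Qed.

Lemma inner0r u : inner u 0 = 0.
Proof.
have := innerPr 1 u 0 0; rewrite scaler0 addr0 mul1r => /eqP.
by rewrite -{1}[inner u 0]addr0 (inj_eq (addrI _)) eq_sym => /eqP.
Qed.

Lemma inner0l u : inner 0 u = 0.
Proof. by rewrite -innerC inner0r rmorph0. Qed.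

Lemma innerBr u v w : inner u (v - w) = inner u v - inner u w.
Proof. by rewrite addrC -scaleN1r innerPr mulN1r addrC. Qed.

Lemma inner_eq0 u : inner u u = 0 -> u = 0.
Proof.
move=> /eqP; rewrite psumr_eq0 => [/allP h|e _]; last first.
  by rewrite mulr_ge0 ?conjs_mul_ge0// ltW// of_real_gt0 weight_gt0.
have u0 e : e \in pos G -> u e = 0.
  move=> ep; have := h e (mem_index_enum _); rewrite ep /= mulf_eq0.
  rewrite gt_eqF ?of_real_gt0 ?weight_gt0//= mulf_eq0 fmorph_eq0 orbb.
  by move/eqP.
apply/val_inj/ffunP => e; rewrite [RHS]ffunE.
have [/u0//|ep] := boolP (e \in pos G).
have := u0 (einv e); rewrite pos_einv ep => /(_ isT).
by rewrite (antisymmetric_funP _ (cochainP u)) => /eqP; rewrite oppr_eq0 => /eqP.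
Qed.

Definition closed_lin (W : set Omega1) : Prop :=
  W 0 /\ forall a u v, W u -> W v -> W (a *: u + v).

Lemma gram_schmidt (ws : seq Omega1) w : exists p,
  (forall W, closed_lin W -> (forall u, u \in ws -> W u) -> W p) /\
  (forall u, u \in ws -> inner u (w - p) = 0).
Proof.
elim: ws w => [|u ws IH] w; first by exists 0; split=> // W [].
have [p [pW wp]] := IH w; have [q [qW uq]] := IH u.
pose v := u - q; pose c := inner v (w - p) / inner v v.
have vW W : closed_lin W -> (forall u', u' \in u :: ws -> W u') -> W v.
  move=> cW sW; rewrite /v addrC -scaleN1r; apply: cW.2; last first.
    by apply: sW; rewrite mem_head.
  by apply: qW => // y yws; apply: sW; rewrite inE yws orbT.
have ov y : y \in u :: ws -> inner y (w - (c *: v + p)) = 0.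
  have wE : w - (c *: v + p) = (- c) *: v + (w - p).
    by rewrite opprD addrCA scaleNr.
  have o y' : y' \in ws -> inner y' (w - (c *: v + p)) = 0.
    by move=> ys; rewrite wE innerPr uq// wp// mulr0 addr0.
  rewrite inE => /orP[/eqP->|]; last exact: o.
  have ov : inner v (w - (c *: v + p)) = 0.
    rewrite wE innerPr /c; have [->|v0] := eqVneq v 0.
      by rewrite !inner0l mulr0 addr0.
    have iv0 : inner v v != 0 by apply: contraNneq v0 => /inner_eq0 ->.
    by rewrite mulNr divfK// addNr.
  have oq : inner (w - (c *: v + p)) q = 0.
    suff : [set y | inner (w - (c *: v + p)) y = 0]%classic q by [].
    apply: qW => [|y' ys /=].
      split=> [/=|b y1 y2 /= h1 h2]; first exact: inner0r.
      by rewrite innerPr h1 h2 mulr0 addr0.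
    by rewrite -innerC o// rmorph0.
  have uE : u = 1 *: v + q by rewrite scale1r subrK.
  by rewrite -innerC {1}uE innerPr oq -[inner _ v]innerC ov rmorph0 mulr0 addr0 rmorph0.
exists (c *: v + p); split=> // W cW sW; apply: cW.2; first exact: vW.
by apply: pW => // y yws; apply: sW; rewrite inE yws orbT.
Qed.

Lemma differential_lin a f g :
  differential (a *: (f : {ffun vertex G -> K^o}) + g)
  = a *: differential f + differential g.
Proof.
apply/val_inj/ffunP => e; rewrite cochainE !ffunE /GRing.scale /=.
ring.
Qed.

Lemma differential0 : differential 0 = 0.
Proof. by apply/val_inj/ffunP => e; rewrite !ffunE subrr. Qed.

Lemma closed_im_d : closed_lin (range differential).
Proof.
split; first by exists 0 => //; exact: differential0.
by move=> a _ _ [f _ <-] [g _ <-]; exists (a *: (f : {ffun _ -> K^o}) + g);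
  rewrite ?differential_lin.
Qed.

Definition dirac (v : vertex G) : {ffun vertex G -> K^o} :=
  [ffun u => (u == v)%:R].

Lemma ffun_dirac (f : {ffun vertex G -> K^o}) : f = \sum_v f v *: dirac v.
Proof.
apply/ffunP => u; rewrite sum_ffunE (bigD1 u)//= big1 => [|v vu].
  by rewrite !ffunE eqxx /GRing.scale /= mulr1 addr0.
by rewrite !ffunE eq_sym (negPf vu) scaler0.
Qed.

Lemma proj_im_d_spec w :
  range differential (proj_im_d w) /\
  forall f, inner (differential f) (w - proj_im_d w) = 0.
Proof.
suff : exists p, (range differential p /\
                 forall u, range differential u -> inner u (w - p) = 0).
  move=> /(xgetPex 0) [im o]; split=> // f; apply: o; by exists f.
have [p [pW o]] :=
  gram_schmidt [seq differential (dirac v) | v <- enum (vertex G)] w.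
exists p; split.
  apply: pW; first exact: closed_im_d.
  by move=> _ /mapP[v _ ->]; exists (dirac v).
move=> _ [f _ <-]; rewrite (ffun_dirac f).
apply: (big_ind (fun f => inner (differential f) (w - p) = 0)).
- by rewrite differential0 -innerC inner0r rmorph0.
- move=> g h g0 h0.
  have -> : differential (g + h) = 1 *: differential g + differential h.
    by rewrite -differential_lin scale1r.
  rewrite -innerC innerPr.
  by rewrite rmorphD rmorphM !innerC g0 h0 mulr0 addr0.
- move=> v _.
  have -> : differential (f v *: dirac v) = f v *: differential (dirac v) + 0.
    by rewrite -differential0 -differential_lin addr0.
  rewrite -innerC innerPr inner0r addr0 rmorphM innerC o ?mulr0//.
  by apply: map_f; rewrite mem_enum.
Qed.

Lemma proj_im_d_unique w p : range differential p ->
  (forall f, inner (differential f) (w - p) = 0) -> proj_im_d w = p.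
Proof.
move=> imp op; have [imq oq] := proj_im_d_spec w.
set q := proj_im_d w in imq oq *.
apply/eqP; rewrite -subr_eq0; apply/eqP/inner_eq0.
have [f _ fE] : range differential (q - p).
  rewrite addrC -scaleN1r; exact: closed_im_d.2.
have -> : inner (q - p) (q - p) = inner (q - p) ((w - p) - (w - q)).
  by congr inner; rewrite opprB [RHS]addrC addrA subrK.
by rewrite innerBr -fE op oq subrr.
Qed.

Lemma proj_im_dP (a : K) (u v : Omega1) :
  proj_im_d (a *: u + v) = a *: proj_im_d u + proj_im_d v.
Proof.
have [imu ou] := proj_im_d_spec u; have [imv ov] := proj_im_d_spec v.
move: (proj_im_d u) (proj_im_d v) imu ou imv ov => p q imp op imq oq.
apply: proj_im_d_unique => [|f]; first exact: closed_im_d.2.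
have -> : a *: u + v - (a *: p + q) = a *: (u - p) + (v - q).
  by rewrite opprD addrACA scalerBr.
by rewrite innerPr op oq mulr0 addr0.
Qed.

Lemma proj_im_d_linear : linear proj_im_d.
Proof. exact: proj_im_dP. Qed.

HB.instance Definition _ :=
  GRing.isLinear.Build K Omega1 Omega1 _ proj_im_d proj_im_d_linear.
End Omega.

(* Main.v *)
(** Let M be the incidence matrix of G with one vertex r removed, L = M X M^T the
reduced Laplacian (X the diagonal matrix of weights), and w_i the differential of
the i-th remaining vertex.  The w_i are a basis of im d with Gram matrix L, so the
projection is given by L^-1 and the right-hand sum over S becomes
sum_{i,j} det(L^-1)_{ij} w_i (x) w_j over k-tuples i, j; moreover T(x) = det L.  By
Jacobi's identity for complementary minors, det L times a k-minor of L^-1 is a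
complementary minor of L, which the Cauchy-Binet expansion turns into a sum over
the (n-k)-sets A of edges of x^A theta_A (x) theta_A, with theta_A a combination
of wedges of the w_i whose coefficients are minors of M.  If A contains a cycle,
the columns of M indexed by A are dependent and theta_A = 0.  If A is a forest,
these columns are the first columns of an integer matrix N' whose inverse has the
coordinates of the basis of B^1(G, A) as its last rows; since det N' = +-1,
Jacobi's identity again gives theta_A = +- det B^A.

Minors are indexed by functions rather than by subsets, at the price of factors
k! and p! (p = n - k): this avoids all signs of shuffles.  *)

From HB Require Import structures.
Require Import Defs.
From mathcomp Require Import all_boot all_order all_algebra all_fingroup.
From mathcomp Require Import boolp reals zify ring.

Set Implicit Arguments.
Unset Strict Implicit.
Unset Printing Implicit Defensive.

Import Order.TTheory GRing.Theory Num.Theory.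
Local Open Scope ring_scope.

(** * Multilinear expansion of wedges *)

Section WedgeExpansion.
Variables (K : comNzRingType) (k : nat) (U : lmodType K).
Implicit Types (v w : {ffun 'I_k -> U}).

Lemma fset_at_id v b : fset_at v b (v b) = v.
Proof. by apply/ffunP => c; rewrite ffunE; case: eqP => [->|]. Qed.

Lemma fset_atC v b c y z : b != c ->
  fset_at (fset_at v b y) c z = fset_at (fset_at v c z) b y.
Proof.
move=> bc; apply/ffunP => j; rewrite !ffunE.
by have [->|//] := eqVneq j c; rewrite eq_sym (negPf bc).
Qed.

Lemma wedgeD v b y z :
  wedge (fset_at v b (y + z)) = wedge (fset_at v b y) + wedge (fset_at v b z).
Proof. by have := wedge_linear v b 1 y z; rewrite !scale1r. Qed.

Lemma wedge0 v b : wedge (fset_at v b 0) = 0.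
Proof. by apply: (addrI (wedge (fset_at v b 0))); rewrite -wedgeD !addr0. Qed.

Lemma wedgeZ v b c y : wedge (fset_at v b (c *: y)) = c *: wedge (fset_at v b y).
Proof. by have := wedge_linear v b c y 0; rewrite wedge0 !addr0. Qed.

Lemma wedge_sum1 (J : finType) (F : J -> U) v b :
  wedge (fset_at v b (\sum_j F j)) = \sum_j wedge (fset_at v b (F j)).
Proof.
exact: (big_morph (fun y => wedge (fset_at v b y)) (wedgeD v b) (wedge0 v b)).
Qed.

Lemma wedge_scale (c : 'I_k -> K) v :
  wedge [ffun b => c b *: v b] = (\prod_b c b) *: wedge v.
Proof.
suff H (r : seq 'I_k) : uniq r ->
    wedge [ffun b => (if b \in r then c b else 1) *: v b]
    = (\prod_(b <- r) c b) *: wedge v.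
  have := H _ (index_enum_uniq 'I_k).
  by under eq_ffun do rewrite mem_index_enum.
elim: r => [_|a r IH /= /andP[ar ur]].
  by rewrite big_nil scale1r; congr wedge; apply/ffunP => b; rewrite ffunE scale1r.
set w := [ffun b => _]; pose w' := [ffun b => (if b \in r then c b else 1) *: v b].
have -> : w = fset_at w' a (c a *: w' a).
  apply/ffunP => b; rewrite !ffunE inE.
  by have [->|//] := eqVneq b a; rewrite (negPf ar) scale1r.
by rewrite wedgeZ fset_at_id (IH ur) big_cons scalerA.
Qed.

Lemma wedge_sum (J : finType) (F : 'I_k -> J -> U) :
  wedge [ffun b => \sum_j F b j]
  = \sum_(i : {ffun 'I_k -> J}) wedge [ffun b => F b (i b)].
Proof.
(* The induction below freezes the slots not yet expanded at a default index [j0], so an empty [J]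
   is handled apart: for k > 0 both sides vanish, and for k = 0 there is exactly one function into
   [J]. *)
have [j0 _|J0] := pickP J; last first.
  have [b _|k0] := pickP 'I_k.
    rewrite [RHS]big1 => [|i _]; last by have := J0 (i b).
    rewrite -[X in wedge X](fset_at_id _ b) ffunE big_pred0 ?wedge0//.
  have e (T : Type) (f g : {ffun 'I_k -> T}) : f = g.
    by apply/ffunP => b; have := k0 b.
  pose i0 : {ffun 'I_k -> J} :=
    [ffun b => match elimTF idP (k0 b) isT with end].
  by rewrite (big_pred1 i0) => [|i]; [congr wedge; apply: e | apply/esym/eqP/e].
have pfP (r : seq 'I_k) (f : {ffun 'I_k -> J}) :
    reflect (forall b, b \notin r -> f b = j0)
      (f \in pfamily j0 (mem r) (fun=> predT)).
  apply: (iffP familyP) => h b.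
    by move=> br; have := h b; rewrite /= ifN // => /eqP.
  by have [br|/h ->] := boolP (b \in r); rewrite /= ?ifT ?ifN// inE.
(* [r] lists the slots already expanded; [i] is frozen to [j0] off [r]. *)
suff H (r : seq 'I_k) : uniq r -> forall w,
    wedge [ffun b => if b \in r then \sum_j F b j else w b]
    = \sum_(i in pfamily j0 (mem r) (fun=> predT))
        wedge [ffun b => if b \in r then F b (i b) else w b].
  have := H _ (index_enum_uniq 'I_k) 0.
  under eq_ffun do rewrite mem_index_enum; move=> ->; apply: eq_big => [i|i _].
    by apply/pfP => b; rewrite mem_index_enum.
  by under eq_ffun do rewrite mem_index_enum.
elim: r => [_ w|a r IH /= /andP[ar ur] w].
  rewrite (big_pred1 [ffun=> j0]) => [|i]; first by congr wedge; apply/ffunP => b; rewrite !ffunE.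
  apply/pfP/eqP => [h|-> b _]; last by rewrite ffunE.
  by apply/ffunP => b; rewrite ffunE h.
pose w' := [ffun b => if b \in r then \sum_j F b j else w b].
have -> : [ffun b => if b \in a :: r then \sum_j F b j else w b]
          = fset_at w' a (\sum_j F a j).
  by apply/ffunP => b; rewrite !ffunE inE; case: eqVneq => [->|].
rewrite wedge_sum1 (partition_big (fun i : {ffun _} => i a) predT)//=.
apply: eq_bigr => j _.
have -> : fset_at w' a (F a j)
    = [ffun b => if b \in r then \sum_j F b j else fset_at w a (F a j) b].
  apply/ffunP => b; rewrite !ffunE.
  by have [->|//] := eqVneq b a; rewrite (negPf ar).
(* Overwriting the value at [a], by [j] or back by [j0], matches the functions frozen off [r] with
   the functions frozen off [a :: r] whose value at [a] is [j]. *)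
rewrite (IH ur); pose seti j (f : {ffun 'I_k -> J}) := fset_at f a j.
rewrite [RHS](reindex_onto (seti j) (seti j0)) => [|f /andP[_ /eqP fa]]; last first.
  by apply/ffunP => b; rewrite !ffunE; case: eqVneq => // ->.
apply: eq_big => [f|f _]; last first.
  congr wedge; apply/ffunP => b; rewrite !ffunE inE.
  by case: (eqVneq b a) => [->|//] /=; rewrite (negPf ar).
rewrite !ffunE !eqxx andbT; apply/pfP/andP => /= [Pf|[/pfP Pf /eqP fE] b br].
  split; [apply/pfP|apply/eqP/ffunP] => b; rewrite !ffunE.
    by rewrite inE negb_or => /andP[/negPf-> /Pf].
  by case: eqVneq => // ->; rewrite Pf.
rewrite -fE !ffunE; case: eqVneq => // ba; have := Pf b.
by rewrite ffunE (negPf ba) inE negb_or ba br => /(_ isT).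
Qed.

(** Polarisation: as a function of the slots [b] and [c] the wedge is biadditive and vanishes on
    equal entries, so expanding it with [v b + v c] in both slots leaves the two mixed terms. *)
Lemma wedge_tperm v b c : b != c ->
  wedge [ffun i => v (tperm b c i)] = - wedge v.
Proof.
move=> bc; pose g y z := wedge (fset_at (fset_at v b y) c z).
have gDl y y' z : g (y + y') z = g y z + g y' z.
  by rewrite /g !(fset_atC _ _ _ bc) wedgeD.
have gDr y z z' : g y (z + z') = g y z + g y z' by rewrite /g wedgeD.
have g0 y : g y y = 0.
  by apply: (wedge_alt bc); rewrite !ffunE !eqxx (negPf bc).
have gE : wedge v = g (v b) (v c) by rewrite /g fset_at_id fset_at_id.
have gtE : wedge [ffun i => v (tperm b c i)] = g (v c) (v b).
  congr wedge; apply/ffunP => i; rewrite !ffunE.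
  by case: tpermP => [->|->|/eqP/negPf-> /eqP/negPf->//]; rewrite ?eqxx// (negPf bc).
apply/eqP; rewrite -addr_eq0 gE gtE; apply/eqP.
by have := g0 (v b + v c); rewrite gDl !gDr !g0 add0r addr0 addrC.
Qed.

Lemma wedge_perm v (s : 'S_k) :
  wedge [ffun i => v (s i)] = (-1) ^+ s *: wedge v.
Proof.
have [ts -> ] := prod_tpermP s; elim: ts v => [|t ts IH] v.
  rewrite big_nil odd_perm1 scale1r => _; congr wedge; apply/ffunP => i.
  by rewrite ffunE perm1.
move=> /= /andP[t12 /IH{}IH]; rewrite big_cons.
under eq_ffun do rewrite permM.
have := wedge_tperm [ffun i => v ((\prod_(t <- ts) tperm t.1 t.2)%g i)] t12.
under eq_ffun do rewrite ffunE; move=> ->.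
by rewrite IH odd_mul_tperm t12 addTb signrN scaleNr.
Qed.

Lemma wedge_not_injective (J : finType) (u : J -> U) (i : 'I_k -> J) :
  ~~ injectiveb i -> wedge [ffun b => u (i b)] = 0.
Proof.
move=> /injectivePn[b [c bc ibc]]; apply: (wedge_alt bc).
by rewrite !ffunE ibc.
Qed.

End WedgeExpansion.

(** * Jacobi's identity *)

Section Counting.
Variables p k : nat.
Local Notation n := (p + k)%N.

Definition perm_tail (s : 'S_n) : {ffun 'I_k -> 'I_n} :=
  [ffun b => s (rshift p b)].

Lemma perm_tail_inj s : injectiveb (perm_tail s).
Proof.
by apply/injectiveP => b c; rewrite !ffunE => /perm_inj/rshift_inj.
Qed.

(** The first p positions receive an enumeration of the complement of the image of [i]. *)
Lemma perm_tail_ex (i : {ffun 'I_k -> 'I_n}) :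
  injectiveb i -> exists s, perm_tail s = i.
Proof.
move=> /injectiveP ii; pose C := ~: [set i b | b in 'I_k].
have cC : #|C| = p by rewrite cardsCs setCK card_imset// !card_ord addnK.
pose f (a : 'I_n) := match split a with
  | inl l => enum_val (cast_ord (esym cC) l) | inr b => i b end.
have fl l : f (lshift k l) = enum_val (cast_ord (esym cC) l).
  by rewrite /f; case: split_ordP => [l' /lshift_inj-> //|b /eqP]; rewrite eq_lrshift.
have fr b : f (rshift p b) = i b.
  by rewrite /f; case: split_ordP => [l' /eqP|c /rshift_inj-> //]; rewrite eq_rlshift.
have flr l b : f (lshift k l) <> f (rshift p b).
  rewrite fl fr => e; have := enum_valP (cast_ord (esym cC) l).
  by rewrite e inE imset_f.
have fi : injective f.
  move=> a c; case: (split_ordP a) => [l|b] ->; case: (split_ordP c) => [l'|b'] ->.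
  - by rewrite !fl => /enum_val_inj/cast_ord_inj->.
  - by move/flr.
  - by move/esym/flr.
  - by rewrite !fr => /ii->.
by exists (perm fi); apply/ffunP => b; rewrite ffunE permE fr.
Qed.

(** Given one permutation [s0] with tail [i], the permutations with this tail are the products
    [t * s0] where [t] moves only the first p positions. *)
Lemma card_perm_tail (i : {ffun 'I_k -> 'I_n}) : injectiveb i ->
  #|[pred s | perm_tail s == i]| = p`!.
Proof.
move=> /perm_tail_ex[s0 s0i]; pose A := [set lshift k l | l in 'I_p].
have -> : p`! = #|A|`! by rewrite card_imset ?card_ord//; apply: lshift_inj.
rewrite -card_perm -[RHS](card_imset _ (mulIg s0)); apply: eq_card => s.
apply/eqP/imsetP => [st|[t tA ->]].
  exists (s * s0^-1)%g; last by rewrite mulgKV.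
  apply/subsetP => a; rewrite !inE permM; apply: contraR => aA.
  case: (split_ordP a) => [l al|b ->]; first by rewrite al imset_f in aA.
  have /ffunP/(_ b) := etrans st (esym s0i); rewrite !ffunE => ->.
  by rewrite permK.
rewrite -s0i; apply/ffunP => b; rewrite !ffunE permM (out_perm tA)//.
by apply/imsetP => -[l _ /eqP]; rewrite eq_rlshift.
Qed.

Lemma sum_perm_tail (V : zmodType) (g : {ffun 'I_k -> 'I_n} -> V) :
  \sum_s g (perm_tail s) = (\sum_(i : {ffun 'I_k -> 'I_n} | injectiveb i) g i) *+ p`!.
Proof.
rewrite (partition_big perm_tail (fun i : {ffun 'I_k -> 'I_n} => injectiveb i)) => [|s _]; last first.
  exact: perm_tail_inj.
rewrite -sumrMnl; apply: eq_bigr => i ii.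
rewrite (eq_bigr (fun=> g i)) => [|s /eqP->//].
by rewrite sumr_const card_perm_tail.
Qed.
End Counting.

Section Jacobi.
Variables (K : comNzRingType) (p k : nat) (U : lmodType K).
Local Notation n := (p + k)%N.

Definition wedge_tail (u : 'I_n -> U) (s : 'S_n) : ext_pow k U :=
  wedge [ffun b => u (s (rshift p b))].

Definition select (i : {ffun 'I_k -> 'I_n}) (a : 'I_n) : 'I_n :=
  match split a with inl l => lshift k l | inr b => i b end.

(** The selection matrix is block lower triangular with an identity block, so its determinant is
    that of the k-by-k block [Z i]. In the Leibniz expansion each permutation [t] of the last k
    positions singles out one tuple [i], and its sign cancels against the sign of the reordered
    wedge: k! equal terms remain. *)
Lemma sum_det_select (u : 'I_n -> U) :
  \sum_(i : {ffun 'I_k -> 'I_n})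
     \det (\matrix_(a, j) (select i a == j)%:R : 'M[K]_n)
       *: wedge [ffun b => u (i b)]
  = (k`!)%:R *: wedge [ffun b => u (rshift p b)].
Proof.
pose Z (i : {ffun 'I_k -> 'I_n}) : 'M[K]_k := \matrix_(b, c) (i b == rshift p c)%:R.
have detZ i : \det (\matrix_(a, j) (select i a == j)%:R : 'M[K]_n) = \det (Z i).
  set X := \matrix_(_, _) _.
  have -> : X = block_mx 1%:M 0 (dlsubmx X) (Z i).
    apply/matrixP => a j; case: (split_ordP a) => l ->; case: (split_ordP j) => c ->;
    rewrite ?block_mxEul ?block_mxEur ?block_mxEdl ?block_mxEdr !mxE// /select.
    - by rewrite (unsplitK (inl l)) eq_lshift.
    - by rewrite (unsplitK (inl l)) eq_lrshift.
    - by rewrite (unsplitK (inr l)).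
  by rewrite det_lblock det1 mul1r.
under eq_bigr do rewrite detZ /determinant scaler_suml.
rewrite exchange_big/= -card_Sn scaler_nat -sumr_const; apply: eq_bigr => t _.
pose it : {ffun 'I_k -> 'I_n} := [ffun b => rshift p (t b)].
rewrite (bigD1 it)//= [X in _ + X]big1 ?addr0 => [|i /eqP iit]; last first.
  have [b ib] : exists b, i b != rshift p (t b).
    apply/existsP; rewrite -negb_forall; apply/negP => /forallP h.
    by apply: iit; apply/ffunP => b; rewrite ffunE; apply/eqP.
  by rewrite (bigD1 b)//= !mxE (negPf ib) mul0r mulr0 scale0r.
rewrite big1 ?mulr1 => [|b _]; last by rewrite !mxE ffunE eqxx.
have := wedge_perm [ffun b => u (rshift p b)] t.
have -> : [ffun b => u (it b)] = [ffun b => [ffun b => u (rshift p b)] (t b)].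
  by apply/ffunP => b; rewrite !ffunE.
by move=> ->; rewrite scalerA -signr_addb addbb scale1r.
Qed.

(* Read with [us] the family of which [u] is the image under [L]: the signed
   products over the first p rows are minors of [L], and the identity says that
   they are, up to [\det L], the complementary minors of its inverse. *)
Lemma jacobi_tail (L : 'M[K]_n) (u us : 'I_n -> U) (s : 'S_n) :
  (forall j, u j = \sum_i L i j *: us i) ->
  \sum_(t : 'S_n) ((-1) ^+ t * \prod_(l < p) L (s (lshift k l)) (t (lshift k l)))
      *: wedge_tail u t
  = ((k`!)%:R * (-1) ^+ s * \det L) *: wedge_tail us s.
Proof.
move=> uE.
pose sel (i : {ffun 'I_k -> 'I_n}) a := s (select i a).
(* Each of the k tail vectors is expanded in the family [us], indexed through [s] so that the rows
   of [L] appear in the order prescribed by [s]. *)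
have tailE t : wedge_tail u t = \sum_(i : {ffun 'I_k -> 'I_n})
    (\prod_b L (s (i b)) (t (rshift p b))) *: wedge [ffun b => us (s (i b))].
  rewrite /wedge_tail; under eq_ffun do rewrite uE (reindex_perm s).
  rewrite wedge_sum; apply: eq_bigr => i _; rewrite -wedge_scale; congr wedge.
  by apply/ffunP => b; rewrite !ffunE.
under eq_bigr do rewrite tailE scaler_sumr.
rewrite exchange_big /=.
(* For fixed [i] the sum over [t] is a Leibniz expansion: the head factors supply the first p rows
   and the expanded tail the last k. *)
transitivity (\sum_(i : {ffun 'I_k -> 'I_n})
   \det (\matrix_(a, j) L (sel i a) j : 'M_n) *: wedge [ffun b => us (s (i b))]).
  apply: eq_bigr => i _; rewrite /determinant scaler_suml; apply: eq_bigr => t _.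
  rewrite scalerA -mulrA; congr ((_ * _) *: _); rewrite [RHS]big_split_ord.
  congr (_ * _); apply: eq_bigr => l _; rewrite mxE /sel /select.
    by rewrite (unsplitK (inl l)).
  by rewrite (unsplitK (inr l)).
(* This matrix is the product of the selection matrix of [i], the permutation matrix of [s] and
   [L]. *)
have detE i : \det (\matrix_(a, j) L (sel i a) j : 'M_n)
    = (-1) ^+ s * \det L * \det (\matrix_(a, j) (select i a == j)%:R : 'M[K]_n).
  rewrite mulrC -det_perm -!det_mulmx; congr determinant.
  rewrite mulmxA; apply/matrixP => a j; rewrite !mxE (bigD1 (sel i a)) //=.
  rewrite big1 => [|c ca]; rewrite !mxE (bigD1 (select i a)) //= !mxE eqxx mul1r.
    rewrite eqxx big1 ?addr0 ?mul1r // => c ca.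
    by rewrite mxE eq_sym (negPf ca) mul0r.
  rewrite eq_sym (negPf ca) big1 ?add0r ?mul0r// => d da.
  by rewrite mxE eq_sym (negPf da) mul0r.
under eq_bigr do rewrite detE -scalerA.
rewrite -scaler_sumr (sum_det_select (fun a => us (s a))) scalerA.
by congr (_ *: _); rewrite mulrC mulrA.
Qed.
End Jacobi.

(** * Gram matrices and tensors *)

Lemma wedge_sum_in (K : comNzRingType) k (U : lmodType K) (J : finType)
    (P : {set J}) (F : 'I_k -> J -> U) :
  wedge [ffun b => \sum_(j in P) F b j]
  = \sum_(i : {ffun 'I_k -> J} | i \in ffun_on P) wedge [ffun b => F b (i b)].
Proof.
under eq_ffun do rewrite big_mkcond.
rewrite wedge_sum [RHS]big_mkcond; apply: eq_bigr => i _.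
case: ifPn => [/ffun_onP iP|]; first by under eq_ffun do rewrite iP.
move=> /forallPn[b /negPf ibP].
by rewrite -[X in wedge X](fset_at_id _ b) ffunE [_ \in P]ibP wedge0.
Qed.

(** A k-set is the image of exactly k! injective functions; this is the source of the factorials
    that come with indexing by functions. *)
Lemma sum_ffun_image (V : zmodType) (E : finType) k (P : {set E})
    (g : {ffun 'I_k -> E} -> V) (h : {set E} -> V) :
  (forall f : {ffun 'I_k -> E}, ~~ injectiveb f -> g f = 0) ->
  (forall f : {ffun 'I_k -> E}, injectiveb f -> f \in ffun_on P -> g f = h [set f b | b in 'I_k]) ->
  \sum_(f : {ffun 'I_k -> E} | f \in ffun_on P) g f
  = (\sum_(S : {set E} | (S \subset P) && (#|S| == k)%N) h S) *+ k`!.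
Proof.
move=> g0 gh; rewrite (bigID (fun f : {ffun 'I_k -> E} => injectiveb f)) /=.
rewrite [X in _ + X]big1 => [|f /andP[_ /g0]//]; rewrite addr0.
rewrite (partition_big (fun f : {ffun 'I_k -> E} => [set f b | b in 'I_k])
  (fun S : {set E} => (S \subset P) && (#|S| == k)%N)) /= => [|f]; last first.
  move=> /andP[/ffun_onP fP /injectiveP fi]; apply/andP; split.
    by apply/subsetP => _ /imsetP[b _ ->].
  by rewrite card_imset ?card_ord.
rewrite -sumrMnl; apply: eq_bigr => S /andP[/subsetP SP /eqP cS].
rewrite (eq_bigr (fun=> h S)) => [|f /andP[/andP[fP fi] /eqP<-]]; last exact: gh.
rewrite sumr_const; congr (_ *+ _).
transitivity (#|S| ^_ #|'I_k|); last by rewrite cS card_ord ffactnn.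
rewrite -card_inj_ffuns_on.
apply: eq_card => f; rewrite !inE.
apply/andP/andP => [[/andP[fP fi] /eqP fS]|[/ffun_onP fS fi]]; split=> //.
- by apply/ffun_onP => b; rewrite -fS imset_f.
- by rewrite fi andbT; apply/ffun_onP => b; apply/SP/fS.
- rewrite eqEcard cS card_imset ?card_ord ?leqnn ?andbT; last exact/injectiveP.
  by apply/subsetP => _ /imsetP[b _ ->]; apply: fS.
Qed.

Section TensorSum.
Variables (R K : comNzRingType) (iota : {rmorphism R -> K}) (U W : lmodType K).
Implicit Types (u : U) (w : W).
Local Notation tens := (@tens R K iota U W).

Lemma tensDl u u' w : tens (u + u') w = tens u w + tens u' w.
Proof. by have := tens_linearl iota 1 u u' w; rewrite rmorph1 !scale1r. Qed.

Lemma tensDr u w w' : tens u (w + w') = tens u w + tens u w'.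
Proof. by have := tens_linearr iota 1 u w w'; rewrite rmorph1 !scale1r. Qed.

Lemma tens0l w : tens 0 w = 0.
Proof. by apply: (addrI (tens 0 w)); rewrite -tensDl !addr0. Qed.

Lemma tens0r u : tens u 0 = 0.
Proof. by apply: (addrI (tens u 0)); rewrite -tensDr !addr0. Qed.

Lemma tensZl a u w : tens (iota a *: u) w = a *: tens u w.
Proof. by have := tens_linearl iota a u 0 w; rewrite tens0l !addr0. Qed.

Lemma tensZr a u w : tens u (iota a *: w) = a *: tens u w.
Proof. by have := tens_linearr iota a u w 0; rewrite tens0r !addr0. Qed.

Lemma tens_suml (I : Type) (r : seq I) (P : pred I) (F : I -> U) w :
  tens (\sum_(i <- r | P i) F i) w = \sum_(i <- r | P i) tens (F i) w.
Proof. exact: (big_morph (tens^~ w) (fun u u' => tensDl u u' w) (tens0l w)). Qed.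

Lemma tens_sumr (I : Type) (r : seq I) (P : pred I) u (F : I -> W) :
  tens u (\sum_(i <- r | P i) F i) = \sum_(i <- r | P i) tens u (F i).
Proof. exact: (big_morph (tens u) (tensDr u) (tens0r u)). Qed.

End TensorSum.

Lemma mul_rearrange (R : comNzRingType) (a b c d e : R) :
  a * (b * c * (d * e)) = b * d * (a * c * e).
Proof. by rewrite (mulrACA b) (mulrCA a) (mulrA a). Qed.

Section Gram.
Variables (R : comNzRingType) (E : finType) (P : {set E}) (x : E -> R).

(** The matrix M X M^T; for the reduced incidence matrix it is the reduced Laplacian L. *)
Definition gram n (M : 'I_n -> E -> R) : 'M[R]_n :=
  \matrix_(i, j) \sum_(e in P) x e * M i e * M j e.

Lemma prod_gram (p n : nat) (M : 'I_n -> E -> R) (s t : 'I_p -> 'I_n) :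
  \prod_l gram M (s l) (t l)
  = \sum_(f : {ffun 'I_p -> E} | f \in ffun_on P)
      (\prod_l x (f l)) * (\prod_l M (s l) (f l)) * (\prod_l M (t l) (f l)).
Proof.
under eq_bigr do rewrite mxE.
by rewrite bigA_distr_big; apply: eq_bigr => f _; rewrite !big_split.
Qed.

(** The Cauchy-Binet formula for det(M X M^T), with functions instead of subsets. Expanding both
    determinants and summing over [f] first turns the entries of [M] into entries of the Gram
    matrix; each of the p! row permutations [s] then contributes the same determinant. *)
Lemma sum_sq_det (p : nat) (M : 'I_p -> E -> R) :
  \sum_(f : {ffun 'I_p -> E} | f \in ffun_on P)
     (\prod_l x (f l)) * \det (\matrix_(i, l) M i (f l)) ^+ 2
  = (\det (gram M)) *+ p`!.
Proof.
rewrite -card_Sn -sumr_const.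
transitivity (\sum_(s : 'S_p) \sum_(t : 'S_p)
    (-1) ^+ s * (-1) ^+ t * \prod_l gram M (s l) (t l)).
  transitivity (\sum_(f : {ffun 'I_p -> E} | f \in ffun_on P)
     \sum_(s : 'S_p) \sum_(t : 'S_p) (-1) ^+ s * (-1) ^+ t *
      ((\prod_l x (f l)) * (\prod_l M (s l) (f l)) * (\prod_l M (t l) (f l)))).
    apply: eq_bigr => f _; rewrite -det_tr expr2 /determinant big_distrlr /=.
    rewrite mulr_sumr; apply: eq_bigr => s _; rewrite mulr_sumr; apply: eq_bigr => t _.
    have e (r : 'S_p) : \prod_i (\matrix_(i, l) M i (f l))^T i (r i) = \prod_l M (r l) (f l).
      by apply: eq_bigr => l _; rewrite !mxE.
    by rewrite !e mul_rearrange.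
  rewrite exchange_big; apply: eq_bigr => s _; rewrite exchange_big.
  by apply: eq_bigr => t _; rewrite prod_gram mulr_sumr.
apply: eq_bigr => s _.
have -> : \det (gram M) = (-1) ^+ s * \det (row_perm s (gram M)).
  by rewrite row_permE det_mulmx det_perm mulrA -signr_addb addbb mul1r.
rewrite /determinant mulr_sumr; apply: eq_bigr => t _; rewrite mulrA; congr (_ * _).
by apply: eq_bigr => l _; rewrite [RHS]mxE.
Qed.

End Gram.

Section GramTensor.
Variables (R K : comNzRingType) (iota : {rmorphism R -> K}) (U : lmodType K).
Variables (E : finType) (P : {set E}) (x : E -> R) (k : nat).

(* k! times the theta_A of the header, for A the image of [f]; its coefficients
   are written as minors in [theta_det]. *)
Definition theta p (M : 'I_(p + k) -> E -> R) (u : 'I_(p + k) -> U)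
    (f : 'I_p -> E) : ext_pow k U :=
  \sum_(s : 'S_(p + k))
     iota ((-1) ^+ s * \prod_l M (s (lshift k l)) (f l)) *: wedge_tail u s.

(** The Cauchy-Binet step combined with Jacobi's identity: summing over [f] first replaces the
    products of entries of [M] by products of entries of [L], which are then traded for the dual
    family [us]. *)
Lemma sum_tens_theta p (M : 'I_(p + k) -> E -> R) (u us : 'I_(p + k) -> U) :
  (forall j, u j = \sum_i iota (gram P x M i j) *: us i) ->
  \sum_(f : {ffun 'I_p -> E} | f \in ffun_on P)
     (\prod_l x (f l)) *: tens iota (theta M u f) (theta M u f)
  = ((k`!)%:R * \det (gram P x M)) *:
     ((\sum_(i : {ffun 'I_k -> 'I_(p + k)})
         tens iota (wedge [ffun b => us (i b)]) (wedge [ffun b => u (i b)])) *+ p`!).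
Proof.
move=> uE; set L := gram P x M in uE *.
transitivity (\sum_(s : 'S_(p + k)) \sum_(t : 'S_(p + k))
    ((-1) ^+ s * (-1) ^+ t * \prod_l L (s (lshift k l)) (t (lshift k l))) *:
      tens iota (wedge_tail u t) (wedge_tail u s)).
  transitivity (\sum_(f : {ffun 'I_p -> E} | f \in ffun_on P)
      \sum_(s : 'S_(p + k)) \sum_(t : 'S_(p + k)) ((-1) ^+ s * (-1) ^+ t *
      ((\prod_l x (f l)) * (\prod_l M (s (lshift k l)) (f l))
       * (\prod_l M (t (lshift k l)) (f l)))) *:
      tens iota (wedge_tail u t) (wedge_tail u s)).
    apply: eq_bigr => f _; rewrite /theta tens_sumr scaler_sumr.
    apply: eq_bigr => s _; rewrite tensZr tens_suml !scaler_sumr.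
    apply: eq_bigr => t _; rewrite tensZl !scalerA; congr (_ *: _).
    by rewrite -mulrA mul_rearrange.
  rewrite exchange_big; apply: eq_bigr => s _; rewrite exchange_big.
  by apply: eq_bigr => t _; rewrite prod_gram mulr_sumr scaler_suml.
(* For fixed [s] the sum over [t] is the one in [jacobi_tail], and the two signs of [s] cancel. *)
have LE (s : 'S_(p + k)) : \sum_(t : 'S_(p + k))
    ((-1) ^+ s * (-1) ^+ t * \prod_l L (s (lshift k l)) (t (lshift k l))) *:
      tens iota (wedge_tail u t) (wedge_tail u s)
    = ((k`!)%:R * \det L) *: tens iota (wedge_tail us s) (wedge_tail u s).
  under eq_bigr do rewrite -mulrA -scalerA -tensZl.
  rewrite -scaler_sumr -tens_suml.
  have := @jacobi_tail K p k U (map_mx iota L) u us s.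
  have {}uE j : u j = \sum_i (map_mx iota L) i j *: us i.
    by rewrite uE; apply: eq_bigr => i _; rewrite [in RHS]mxE.
  move=> /(_ uE); rewrite det_map_mx.
  under eq_bigr do under eq_bigr do rewrite mxE.
  under eq_bigr do rewrite -(rmorph_sign iota) -rmorph_prod -rmorphM.
  move=> ->; rewrite -(rmorph_nat iota) -(rmorph_sign iota) -!rmorphM tensZl scalerA.
  by congr (_ *: _); rewrite mulrA (mulrCA _ (k`!)%:R) -signr_addb addbb mulr1.
under eq_bigr do rewrite LE.
rewrite -scaler_sumr; congr (_ *: _).
pose g (i : {ffun 'I_k -> 'I_(p + k)}) :=
  tens iota (wedge [ffun b => us (i b)]) (wedge [ffun b => u (i b)]).
(* Only the tail of [s] matters, and each injective tail occurs p! times; tuples that are not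
   injective have zero wedge. *)
transitivity (\sum_(s : 'S_(p + k)) g (perm_tail s)).
  by apply: eq_bigr => s _; rewrite /g /wedge_tail; congr (tens _ (wedge _) (wedge _));
     apply/ffunP => b; rewrite !ffunE.
rewrite sum_perm_tail; congr (_ *+ _); rewrite [RHS](bigID (fun i : {ffun 'I_k -> 'I_(p + k)} => injectiveb i)) /=.
by rewrite [X in _ + X]big1 ?addr0// => i ii; rewrite /g wedge_not_injective// tens0l.
Qed.

(** The coefficients [M] come from the base ring of the tensor product, so they can cross it:
    expanding the right factor in [es] and regrouping on the left passes from a sum over vertex
    tuples to one over edge tuples. *)
Lemma sum_tens_dual n (M : 'I_n -> E -> R) (u us : 'I_n -> U) (es : E -> U) :
  (forall j, u j = \sum_(e in P) iota (M j e) *: es e) ->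
  \sum_(i : {ffun 'I_k -> 'I_n})
     tens iota (wedge [ffun b => us (i b)]) (wedge [ffun b => u (i b)])
  = \sum_(f : {ffun 'I_k -> E} | f \in ffun_on P)
     tens iota (wedge [ffun b => \sum_j iota (M j (f b)) *: us j])
       (wedge [ffun b => es (f b)]).
Proof.
move=> uE.
transitivity (\sum_(i : {ffun 'I_k -> 'I_n}) \sum_(f : {ffun 'I_k -> E} | f \in ffun_on P)
   (\prod_b M (i b) (f b)) *:
     tens iota (wedge [ffun b => us (i b)]) (wedge [ffun b => es (f b)])).
  apply: eq_bigr => i _; under [in wedge [ffun b => u _]]eq_ffun do rewrite uE.
  rewrite wedge_sum_in tens_sumr; apply: eq_bigr => f _.
  rewrite -tensZr rmorph_prod -wedge_scale; congr (tens _ _ (wedge _)).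
  by apply/ffunP => b; rewrite !ffunE.
rewrite exchange_big; apply: eq_bigr => f _; rewrite wedge_sum tens_suml.
apply: eq_bigr => i _; rewrite -tensZl rmorph_prod -wedge_scale.
by congr (tens _ (wedge _) _); apply/ffunP => b; rewrite !ffunE.
Qed.

End GramTensor.

(** * Forests *)

Lemma map_uniq_inj (T1 T2 : eqType) (f : T1 -> T2) (s : seq T1) :
  uniq [seq f x | x <- s] -> {in s &, injective f}.
Proof.
elim: s => //= a s IH /andP[fa us] x y; rewrite !inE.
move=> /orP[/eqP->|xs] /orP[/eqP->|ys] // e; last exact: IH.
  by rewrite e map_f in fa.
by rewrite -e map_f in fa.
Qed.

Section Connectivity.
Variable G : graph.
Implicit Types (S F A : {set edge G}) (u w : vertex G).

Lemma einv_eq (e f : edge G) : (einv e == f) = (e == einv f).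
Proof. exact: (inv_eq (@einvK G)). Qed.

Lemma einvI : injective (@einv G).
Proof. exact: (can_inj (@einvK G)). Qed.

Lemma subgraph_einv S e : subgraph S -> (einv e \in S) = (e \in S).
Proof.
move=> /forall_inP sS; apply/idP/idP => [/sS|/sS//]; by rewrite einvK.
Qed.

Lemma connect_const (T : Type) (g : vertex G -> T) S u w :
  (forall e, e \in S -> g (src e) = g (tgt e)) ->
  connect (adj S) u w -> g u = g w.
Proof.
move=> gS /connectP[q + ->]; elim: q u => //= a q IH u.
by move=> /andP[/exists_inP[e /gS ge /andP[/eqP<- /eqP ea]] /IH <-]; rewrite ge ea.
Qed.

Lemma connect_edge S e : e \in S -> connect (adj S) (src e) (tgt e).
Proof. by move=> eS; apply/connect1/exists_inP; exists e; rewrite ?eqxx. Qed.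

Lemma adj_sym S : subgraph S -> connect_sym (adj S).
Proof.
move=> sS; apply: sym_connect_sym => u w.
by apply/exists_inP/exists_inP => -[e eS /andP[/eqP<- /eqP<-]];
   exists (einv e); rewrite ?subgraph_einv ?src_einv ?tgt_einv ?eqxx.
Qed.

Lemma connected_const (T : Type) (g : vertex G -> T) S u w :
  subgraph S -> connected S ->
  (forall e, e \in S -> g (src e) = g (tgt e)) -> g u = g w.
Proof.
move=> sS /eqP cS gS; apply: connect_const gS _.
rewrite -root_connect; last exact: adj_sym.
have rP v : fingraph.root (adj S) v \in predI (roots (adj S)) (mem predT).
  by rewrite inE /= andbT; apply: roots_root; apply: adj_sym.
have /card_le1P/(_ _ (rP u)) := eq_leq cS.
by move=> /(_ (fingraph.root (adj S) w)); rewrite rP inE eq_sym => <-.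
Qed.

Lemma edge_path S u q : path (adj S) u q -> exists p : seq (edge G),
  [/\ {subset p <= S}, [seq tgt e | e <- p] = q & [seq src e | e <- p] = belast u q].
Proof.
elim: q u => [u _|a q IH u /= /andP[/exists_inP[e eS /andP[/eqP eu /eqP ea]]]].
  by exists [::].
move=> /IH[p [pS tp sp]]; exists (e :: p); split=> /=.
- by move=> f; rewrite inE => /orP[/eqP->|/pS].
- by rewrite ea tp.
- by rewrite eu sp.
Qed.

Definition delete_edge (e : edge G) S := S :\ e :\ einv e.

Lemma in_delete_edge e S f :
  (f \in delete_edge e S) = [&& f != einv e, f != e & f \in S].
Proof. by rewrite !inE. Qed.

(** A simple path from the target of [e] back to its source that avoids [e] and its inverse would
    close up with [e] to a cycle. *)
Lemma acyclic_bridge F e : subgraph F -> acyclic F -> e \in F ->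
  ~~ connect (adj (delete_edge e F)) (tgt e) (src e).
Proof.
move=> sF /asboolP aF eF; apply/negP => /connectP[q0 /shortenP[q pq uq _] eq].
have [p [pS tp sp]] := edge_path pq.
have /aF/negP : {subset e :: p <= F}.
  move=> f; rewrite inE => /orP[/eqP->//|/pS].
  by rewrite in_delete_edge => /and3P[].
apply; rewrite /graph_cycle /=; apply/andP; split; last first.
  by rewrite sp eq -rcons_uniq -lastI.
have He f : f \in p -> f != einv e.
  by move=> /pS; rewrite in_delete_edge => /and3P[].
(* Generalised to any remaining stretch [p'] of the path after a current edge [e1], ending with [e].
   The invariant is that neither [e] nor an edge of [p'] reverses [e1]. *)
suff gen (p' q' : seq _) e1 u : (forall f, f \in p' -> f != einv e1) ->
    src e = last u q' -> uniq (u :: q') -> [seq tgt f | f <- p'] = q' ->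
    [seq src f | f <- p'] = belast u q' -> {subset p' <= delete_edge e F} ->
    tgt e1 = u -> e != einv e1 ->
    path (fun f g => (tgt f == src g) && (g != einv f)) e1 (rcons p' e).
  by apply: (gen p q e (tgt e)) => //; rewrite eq_sym einv_neq.
move=> {p q pq uq eq pS tp sp He} He eq uq tp sp pS.
elim: p' q' e1 u He eq uq tp sp pS => [|f p IH] q e1 u He eq uq tp sp pS eu Hn /=.
  by rewrite -tp /= in eq; rewrite eu -eq eqxx Hn.
case: q uq tp sp eq => // a q /= /andP[uq uq'] [fa tp] [fu sp] eq.
rewrite eu fu eqxx He ?mem_head//=; apply: (IH q f a) => //.
(* A later edge reversing [f] would end at the source [u] of [f], which the simple path does not
   visit again. *)
- move=> g gp; apply: contraNneq uq => ge; rewrite inE -tp; apply/orP; right.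
  by apply/mapP; exists g => //; rewrite ge tgt_einv fu.
- by move=> g gp; apply: pS; rewrite inE gp orbT.
- have := pS _ (mem_head f p); rewrite in_delete_edge => /and3P[+ _ _].
  by rewrite eq_sym einv_eq.
Qed.

(** Deleting the bridge [e0] separates its ends; the function is the indicator of the component of
    the target of [e0], which changes only across [e0]. *)
Lemma acyclic_dual F e0 : subgraph F -> acyclic F -> e0 \in F ->
  exists g : {ffun vertex G -> int}, forall e, e \in F ->
    g (tgt e) - g (src e) = (e == e0)%:Z - (e == einv e0)%:Z.
Proof.
move=> sF aF e0F; have nb := acyclic_bridge sF aF e0F.
have sD : subgraph (delete_edge e0 F).
  apply/forall_inP => e; rewrite !in_delete_edge => /and3P[h1 h2 h3].
  by rewrite subgraph_einv // h3 einv_eq einvK h2 einv_eq h1.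
have h : (tgt e0 == src e0) = false.
  by apply/negP => /eqP h; rewrite h connect0 in nb.
have h1 : (e0 == einv e0) = false by rewrite eq_sym (negPf (einv_neq e0)).
exists [ffun u => (connect (adj (delete_edge e0 F)) (tgt e0) u)%:Z] => e eF.
rewrite !ffunE; have [->|ee0] := eqVneq e e0.
  by rewrite connect0 (negPf nb) h1.
have [->|eie0] := eqVneq e (einv e0).
  by rewrite src_einv tgt_einv connect0 (negPf nb).
have /connect_edge ce : e \in delete_edge e0 F by rewrite in_delete_edge eie0 ee0.
rewrite (same_connect_r (adj_sym sD) ce) subrr; by [].
Qed.

Lemma cycle_tgt (c : seq (edge G)) :
  path.cycle (fun e f => (tgt e == src f) && (f != einv e)) c ->
  [seq tgt e | e <- c] = rot 1 [seq src e | e <- c].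
Proof.
case: c => //= e p; rewrite rot1_cons; move: {1 3}e.
elim: p => [|f p IH] e1 /=; first by rewrite andbT => /andP[/eqP-> _].
by move=> /andP[/andP[/eqP-> _] /IH ->].
Qed.

(** The inverse of [e] starts where the successor of [e] starts. If both lay on the cycle they would
    be equal, since sources are distinct, and the cycle would backtrack. *)
Lemma cycle_einv (c : seq (edge G)) e : graph_cycle c -> e \in c -> einv e \notin c.
Proof.
move=> /and3P[_ cc uc] ec; have /andP[/eqP ne nn] := next_cycle cc ec.
apply: contraNN nn => ic; apply/eqP.
by apply: (map_uniq_inj uc); rewrite ?mem_next// -ne src_einv.
Qed.

(** The coefficients are the signed indicator of a cycle: a coboundary sums to zero along it, and
    the indicator is nonzero because a cycle never contains an edge and its inverse. *)
Lemma cyclic_dependence F (A := F :&: pos G) : subgraph F -> ~~ acyclic F ->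
  exists2 c : edge G -> int, exists2 e, e \in A & c e != 0 &
  forall g : vertex G -> int, \sum_(e in A) c e * (g (tgt e) - g (src e)) = 0.
Proof.
move=> sF /asboolP/existsNP[c /not_implyP[cF /negP]]; rewrite negbK => gc.
have /and3P[c0 cc uc] := gc; have uc' := map_uniq uc.
exists (fun e => (e \in c)%:Z - (einv e \in c)%:Z).
  have [e ec] : exists e, e \in c by case: (c) c0 => // e p _; exists e; apply: mem_head.
  have en := cycle_einv gc ec.
  have [ep|ep] := boolP (e \in pos G).
    by exists e; rewrite ?inE ?ep ?cF// ec (negPf en).
  exists (einv e); first by rewrite inE subgraph_einv// cF// pos_einv ep.
  by rewrite einvK ec (negPf en).
move=> g; pose h e := g (tgt e) - g (src e).
have hN e : h (einv e) = - h e by rewrite /h tgt_einv src_einv opprB.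
(* An edge of the cycle outside [pos G] is replaced by its inverse, which changes the sign of
   [h]. *)
transitivity (\sum_(e in F | e \in c) h e).
  rewrite [RHS](bigID (fun e => e \in pos G)) /=.
  rewrite [X in _ + X](reindex_inj einvI) /=.
  rewrite [X in _ = X + _](eq_bigl (fun e => (e \in A) && (e \in c))); last first.
    by move=> e; rewrite inE andbAC.
  rewrite [X in _ + X](eq_bigl (fun e => (e \in A) && (einv e \in c))); last first.
    by move=> e; rewrite /A inE subgraph_einv// pos_einv negbK andbAC.
  rewrite !big_mkcondr -big_split; apply: eq_bigr => e _ /=.
  rewrite hN mulrBl -/(h e).
  by do 2![case: (_ \in c)]; rewrite ?mul1r ?mul0r ?addr0 ?subr0.
rewrite (eq_bigl (mem c)) => [|e]; last by rewrite andb_idl// => /cF.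
rewrite -big_uniq // sumrB.
rewrite -(big_map (@tgt G) predT g) -(big_map (@src G) predT g) cycle_tgt//.
by rewrite (perm_big [seq src e | e <- c]) ?subrr// perm_rot.
Qed.

End Connectivity.

Section Forests.
Variable G : graph.
Implicit Types (F : {set edge G}) (u w : vertex G).

Lemma connect_const_pos (T : Type) (g : vertex G -> T) F u w : subgraph F ->
  (forall e, e \in F :&: pos G -> g (src e) = g (tgt e)) ->
  connect (adj F) u w -> g u = g w.
Proof.
move=> sF gF; apply: connect_const => e eF.
have [ep|ep] := boolP (e \in pos G); first by apply: gF; rewrite inE eF.
have := gF (einv e); rewrite src_einv tgt_einv => -> //.
by rewrite inE subgraph_einv// eF pos_einv.
Qed.

Lemma forest_dual F : subgraph F -> acyclic F ->
  exists g : edge G -> {ffun vertex G -> int},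
  forall e0 e, e0 \in F :&: pos G -> e \in F :&: pos G ->
    g e0 (tgt e) - g e0 (src e) = (e == e0)%:Z.
Proof.
move=> sF aF; apply/(@fin_all_exists (edge G) (fun=> {ffun vertex G -> int})
  (fun e0 g => forall e, e0 \in F :&: pos G -> e \in F :&: pos G ->
    g (tgt e) - g (src e) = (e == e0)%:Z)) => e0.
have [e0F|] := boolP (e0 \in F); last first.
  by move=> /negPf e0F; exists 0 => e; rewrite inE e0F.
have [g gP] := acyclic_dual sF aF e0F.
exists g => e; rewrite !inE => /andP[_ e0p] /andP[eF ep]; rewrite gP//.
have -> : (e == einv e0) = false; last by rewrite subr0.
by apply: contraTF e0p => /eqP ee; rewrite ee pos_einv in ep.
Qed.

(** Two integer matrices are mutually inverse, which gives both inequalities between their sizes.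
    The rows of [Q] and [C] are the functions dual to the edges, normalised to vanish at the
    component roots, and the indicators of the components; the columns of [D] and [E] are the
    boundaries of the edges and the roots. *)
Lemma forest_card F : subgraph F -> acyclic F ->
  (#|F :&: pos G| + components F = #|vertex G|)%N.
Proof.
move=> sF aF; have [g gP] := forest_dual sF aF.
pose A := F :&: pos G; pose rt := fingraph.root (adj F).
have symF := adj_sym sF.
have rtE e : e \in A -> rt (src e) = rt (tgt e).
  by rewrite inE => /andP[eF _]; apply/(fingraph.rootP symF)/connect_edge.
pose S : {set vertex G} := [set u | roots (adj F) u].
have rtS u : rt u \in S by rewrite inE; apply: roots_root.
have rtK u : u \in S -> rt u = u by rewrite inE => /eqP.
have cS : components F = #|S|.
  by apply: eq_card => u; rewrite !inE andbT.
pose q e u := g e u - g e (rt u).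
have qE e0 e : e0 \in A -> e \in A -> q e0 (tgt e) - q e0 (src e) = (e == e0)%:Z.
  by move=> e0A eA; rewrite /q (rtE e eA) opprB addrA subrK; apply: gP.
pose d u e : int := (u == tgt e)%:Z - (u == src e)%:Z.
have delta (f : vertex G -> int) w : \sum_u f u * (u == w)%:Z = f w.
  rewrite (bigD1 w) //= eqxx mulr1 big1 ?addr0// => u /negPf->; exact: mulr0.
have sum_d (f : vertex G -> int) e : \sum_u f u * d u e = f (tgt e) - f (src e).
  by under eq_bigr do rewrite mulrBr; rewrite sumrB !delta.
have sum_vertex (f : vertex G -> int) : \sum_(j < #|vertex G|) f (enum_val j) = \sum_u f u.
  by rewrite -(big_enum_val f).
pose Q : 'M[int]_(#|A|, #|vertex G|) := \matrix_(l, j) q (enum_val l) (enum_val j).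
pose C : 'M[int]_(#|S|, #|vertex G|) :=
  \matrix_(a, j) (rt (enum_val j) == enum_val a)%:Z.
pose D : 'M[int]_(#|vertex G|, #|A|) := \matrix_(j, l) d (enum_val j) (enum_val l).
pose E : 'M[int]_(#|vertex G|, #|S|) := \matrix_(j, a) (enum_val j == enum_val a)%:Z.
rewrite cS; apply/eqP; rewrite eqn_leq; apply/andP; split.
  apply: (@mulmx1_min _ _ _ (col_mx Q C) (row_mx D E)).
  rewrite mul_col_row scalar_mx_block; congr block_mx; apply/matrixP => l i; rewrite !mxE.
  - under eq_bigr do rewrite !mxE.
    rewrite (sum_vertex (fun u => q (enum_val l) u * d u (enum_val i))) sum_d qE ?enum_valP//.
    by rewrite (inj_eq enum_val_inj) eq_sym; case: (_ == _).
  - under eq_bigr do rewrite !mxE.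
    rewrite (sum_vertex (fun u => q (enum_val l) u * (u == enum_val i)%:Z)).
    by rewrite delta /q rtK ?enum_valP// subrr.
  - under eq_bigr do rewrite !mxE.
    rewrite (sum_vertex (fun u => (rt u == enum_val l)%:Z * d u (enum_val i))) sum_d.
    by rewrite rtE ?enum_valP// subrr.
  - under eq_bigr do rewrite !mxE.
    rewrite (sum_vertex (fun u => (rt u == enum_val l)%:Z * (u == enum_val i)%:Z)).
    by rewrite delta rtK ?enum_valP// (inj_eq enum_val_inj) eq_sym; case: (_ == _).
apply: (@mulmx1_min _ _ _ (row_mx D E) (col_mx Q C)).
rewrite mul_row_col; apply/matrixP => i j; rewrite !mxE.
set u := enum_val i; set w := enum_val j.
(* The entry of the product at [u], [w] is correct exactly when [h] agrees at [w] and at its root;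
   duality of [g] makes [h] constant along the edges of [F]. *)
pose h w := (u == w)%:Z - \sum_(e in A) d u e * g e w.
have hc e : e \in A -> h (src e) = h (tgt e).
  move=> eA.
  have : \sum_(e0 in A) d u e0 * g e0 (tgt e) - \sum_(e0 in A) d u e0 * g e0 (src e)
         = d u e.
    rewrite -sumrB (bigD1 e eA) /= -mulrBr gP// eqxx mulr1.
    rewrite big1 ?addr0// => e0 /andP[e0A e0e].
    by rewrite -mulrBr gP// eq_sym (negPf e0e) mulr0.
  rewrite /h {3}/d; move: (\sum_(e in A) _) (\sum_(e in A) _) => a b; lia.
have hrt : h w = h (rt w) by apply: (connect_const_pos sF hc); apply: connect_root.
under eq_bigr do rewrite !mxE.
rewrite -(big_enum_val (fun e => d u e * q e w)) /=.
under [X in _ + X]eq_bigr do rewrite !mxE.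
rewrite -(big_enum_val (fun a => (u == a)%:Z * (rt w == a)%:Z)) /=.
rewrite [X in _ + X](bigD1 (rt w)) //= eqxx mulr1 [X in _ + (_ + X)]big1; last first.
  by move=> a /andP[_ /negPf aw]; rewrite eq_sym in aw; rewrite aw mulr0.
rewrite addr0 /q; under eq_bigr do rewrite mulrBr; rewrite sumrB.
have uw : (i == j) = (u == w) by rewrite (inj_eq enum_val_inj).
rewrite uw; apply/eqP; rewrite -subr_eq0; apply/eqP.
transitivity (h (rt w) - h w); last by rewrite hrt subrr.
rewrite /h (_ : _%:R = (u == w)%:Z); last by case: (u == w).
move: (\sum_(e in A) _) (\sum_(e in A) _) => a b; lia.
Qed.
End Forests.

(** * Incidence coordinates *)

Section Incidence.
Variable G : graph.

Definition rooted n (r : vertex G) (v : 'I_n -> vertex G) : Prop :=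
  injective v /\ forall u, (u \in codom v) = (u != r).

Lemma rooted_ex n : #|vertex G| = n.+1 -> exists r (v : 'I_n -> vertex G), rooted r v.
Proof.
move=> cV; have /card_gt0P[r _] : (0 < #|vertex G|)%N by rewrite cV.
have cr : #|[set~ r]| = n by rewrite cardsC1 cV.
exists r, (fun i => enum_val (cast_ord (esym cr) i)); split.
  by move=> i j /enum_val_inj/cast_ord_inj.
move=> u; apply/codomP/idP => [[i ->]|ur].
  by have := enum_valP (cast_ord (esym cr) i); rewrite !inE.
have uC : u \in [set~ r] by rewrite !inE.
by exists (cast_ord cr (enum_rank_in uC u)); rewrite cast_ordK enum_rankK_in.
Qed.

(** The incidence matrix M of the header, over the integers; under [rooted r v] the row of [r] is
    the one left out. *)
Definition inc n (v : 'I_n -> vertex G) (i : 'I_n) (e : edge G) : int :=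
  (tgt e == v i)%:Z - (src e == v i)%:Z.

Lemma inc_einv n (v : 'I_n -> vertex G) i e : inc v i (einv e) = - inc v i e.
Proof. by rewrite /inc tgt_einv src_einv opprB. Qed.

Variables (n : nat) (r : vertex G) (v : 'I_n -> vertex G).
Hypothesis rv : rooted r v.

Lemma sum_rooted (A : zmodType) (f : vertex G -> A) u : f r = 0 ->
  \sum_i f (v i) *~ (u == v i)%:Z = f u.
Proof.
move=> fr; have [vi vr] := rv; have [->|] := eqVneq u r.
  rewrite big1 ?fr// => i _; have [e|_] := eqVneq r (v i); last by [].
  by rewrite -e fr mul0rz.
rewrite -vr => /codomP[j ->]; rewrite (bigD1 j) //= eqxx mulr1z big1 ?addr0// => i ij.
by rewrite (inj_eq vi) eq_sym (negPf ij).
Qed.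

Lemma sum_inc (A : zmodType) (f : vertex G -> A) e : f r = 0 ->
  \sum_i f (v i) *~ inc v i e = f (tgt e) - f (src e).
Proof.
by move=> fr; under eq_bigr do rewrite mulrzBr; rewrite sumrB !sum_rooted.
Qed.

Lemma sum_inc_sub (A : zmodType) (f : vertex G -> A) e :
  \sum_i (f (v i) - f r) *~ inc v i e = f (tgt e) - f (src e).
Proof.
by rewrite (sum_inc (f := fun u => f u - f r)) ?subrr// opprB addrA subrK.
Qed.

Hypothesis cG : connected [set: edge G].

(** Extended by zero at [r], the coefficients form a function [f] with zero coboundary, hence
    constant on the connected graph, hence zero. *)
Lemma inc_free (A : zmodType) (c : 'I_n -> A) :
  (forall e, \sum_i c i *~ inc v i e = 0) -> forall i, c i = 0.
Proof.
move=> c0; have [vi vr] := rv.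
pose f u := \sum_i c i *~ (u == v i)%:Z.
have fv i : f (v i) = c i.
  rewrite /f (bigD1 i) //= eqxx mulr1z big1 ?addr0// => j ji.
  by rewrite (inj_eq vi) eq_sym (negPf ji).
have fr : f r = 0.
  rewrite /f big1 // => i _; have [e|_] := eqVneq r (v i); last by [].
  by have := codom_f v i; rewrite vr -e eqxx.
move=> i; rewrite -fv -fr; apply: (connected_const (g := f) _ _ _ cG).
  by apply/forall_inP => e _; rewrite in_setT.
move=> e _; apply/eqP; rewrite eq_sym -subr_eq0 -(sum_inc e fr); apply/eqP.
by under eq_bigr do rewrite fv.
Qed.

End Incidence.

Section Eval.
Variables (G : graph) (A : zmodType) (e : edge G).

Definition cochain_eval (b : cochain G A) : A := b e.

Lemma cochain_eval_morphism : zmod_morphism cochain_eval.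
Proof. by move=> b c; rewrite /cochain_eval !ffunE. Qed.

HB.instance Definition _ :=
  GRing.isZmodMorphism.Build _ _ cochain_eval cochain_eval_morphism.

Lemma cochain_evalMz (b : cochain G A) m : (b *~ m) e = b e *~ m.
Proof. exact: (raddfMz cochain_eval). Qed.

Lemma cochain_evalB (b c : cochain G A) : (b - c) e = b e - c e.
Proof. exact: (raddfB cochain_eval). Qed.

Lemma cochain_eval_sum I (s : seq I) (P : pred I) (F : I -> cochain G A) :
  (\sum_(i <- s | P i) F i) e = \sum_(i <- s | P i) F i e.
Proof. exact: (raddf_sum cochain_eval). Qed.
End Eval.

(** * Bases of coboundaries adapted to a forest *)

Section Unimodular.
Variables (G : graph) (p k : nat) (r : vertex G) (v : 'I_(p + k) -> vertex G).
Hypotheses (rv : rooted r v) (cG : connected [set: edge G]).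
Variables (F : {set edge G}) (f : {ffun 'I_p -> edge G}).
Hypotheses (fi : injective f) (fF : [set f l | l in 'I_p] = F :&: pos G).
Hypotheses (sF : subgraph F) (aF : acyclic F).

Lemma vanish_pos (b : int_cochain G) :
  (forall l, b (f l) = 0) -> forall e, e \in F -> b e = 0.
Proof.
have bN e : b (einv e) = - b e by apply: (antisymmetric_funP _ (cochainP b)).
move=> b0 e eF; have [ep|ep] := boolP (e \in pos G).
  have : e \in F :&: pos G by rewrite inE eF.
  by rewrite -fF => /imsetP[l _ ->].
have : einv e \in F :&: pos G by rewrite inE subgraph_einv// eF pos_einv.
by rewrite -fF => /imsetP[l _ el]; apply/eqP; rewrite -oppr_eq0 -bN el b0.
Qed.

(** The coboundaries of the functions dual to the edges of [F], followed by [B], form a basis of all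
    coboundaries. The rows of [N] are their coordinates in the vertex coboundaries; [N'] expresses
    the vertex coboundaries in them. *)
Lemma forest_unimodular (B : {ffun 'I_k -> int_cochain G}) : Zbasis (B1_rel F) B ->
  exists N N' : 'M[int]_(p + k),
  [/\ N' *m N = 1%:M,
      forall j l, N' j (lshift k l) = inc v j (f l) &
      forall b e, B b e = \sum_j N (rshift p b) j * inc v j e].
Proof.
move=> [BF Bgen].
have fA l : f l \in F :&: pos G by rewrite -fF imset_f.
have [g gP] := forest_dual sF aF.
have gf l l' : g (f l) (tgt (f l')) - g (f l) (src (f l')) = (l' == l)%:Z.
  by rewrite gP// (inj_eq fi).
have [h hP] : exists h : 'I_k -> {ffun vertex G -> int}, forall b, B b = coboundary (h b).
  exact: (fin_all_exists (fun b => (BF b).1)).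
pose om j : int_cochain G := coboundary [ffun u => (u == v j)%:Z].
have omE j e : om j e = inc v j e by rewrite !ffunE.
(* Subtracting from the coboundary of a vertex its values on the edges of the forest leaves an
   element of B^1(G,F), which has integer coordinates in [B]. *)
pose rest j := om j - \sum_l coboundary (g (f l)) *~ inc v j (f l).
have restB j : B1_rel F (rest j).
  split.
    exists ([ffun u => (u == v j)%:Z] - \sum_l [ffun u => g (f l) u * inc v j (f l)]).
    apply/val_inj/ffunP => e.
    rewrite [LHS]cochain_evalB cochain_eval_sum !ffunE !sum_ffunE.
    rewrite (_ : \sum_i (coboundary (g (f i)) *~ inc v j (f i)) e =
      \sum_i [ffun u => g (f i) u * inc v j (f i)] (tgt e)
      - \sum_i [ffun u => g (f i) u * inc v j (f i)] (src e)).
      by rewrite [in LHS]opprD addrACA -opprD.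
    rewrite -sumrB; apply: eq_bigr => l _.
    by rewrite cochain_evalMz !ffunE -mulrzr intz mulrBl.
  apply: vanish_pos => l; rewrite cochain_evalB cochain_eval_sum omE.
  rewrite (bigD1 l) //= big1 => [|l' l'l]; rewrite cochain_evalMz ffunE gf.
    by rewrite eqxx addr0 -mulrzr intz mul1r subrr.
  by rewrite eq_sym (negPf l'l) mul0rz.
have [c cP] : exists c : 'I_(p + k) -> {ffun 'I_k -> int},
    forall j, rest j = \sum_b B b *~ c j b.
  apply: (fin_all_exists (P := fun j (c : {ffun 'I_k -> int}) =>
    rest j = \sum_b B b *~ c b)) => j; have [c [cE _]] := Bgen _ (restB j).
  by exists c.
pose N := \matrix_(i, j) match split i with
  | inl l => g (f l) (v j) - g (f l) r | inr b => h b (v j) - h b r end.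
pose N' := \matrix_(j, i) match split i with
  | inl l => inc v j (f l) | inr b => c j b end.
have Nl l e : \sum_j N (lshift k l) j * inc v j e
    = g (f l) (tgt e) - g (f l) (src e).
  rewrite -(sum_inc_sub rv); apply: eq_bigr => j _.
  by rewrite mxE (unsplitK (inl l)) -mulrzr intz.
have Nr b e : B b e = \sum_j N (rshift p b) j * inc v j e.
  rewrite hP ffunE -(sum_inc_sub rv); apply: eq_bigr => j _.
  by rewrite mxE (unsplitK (inr b)) -mulrzr intz.
have N'l j l : N' j (lshift k l) = inc v j (f l) by rewrite mxE (unsplitK (inl l)).
exists N, N'; split=> //.
apply/matrixP => j j'; apply/eqP; rewrite -subr_eq0; apply/eqP.
(* A row of [N' *m N - 1] is zero once the combination of vertex coboundaries it defines is zero. *)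
move: j'; apply: (inc_free rv cG) => e.
under eq_bigr do rewrite -mulrzr intz mulrBl.
rewrite sumrB [X in _ - X](bigD1 j) //= mxE eqxx mul1r [X in _ - (_ + X)]big1 ?addr0; last first.
  by move=> i ij; rewrite mxE eq_sym (negPf ij) mul0r.
under eq_bigr do rewrite mxE mulr_suml.
rewrite exchange_big /= big_split_ord /=.
have restE : rest j e = \sum_b B b e * N' j (rshift p b).
  rewrite cP cochain_eval_sum; apply: eq_bigr => b _.
  by rewrite cochain_evalMz -mulrzr intz mxE (unsplitK (inr b)).
rewrite [X in _ + X - _](_ : _ = rest j e); last first.
  rewrite restE; apply: eq_bigr => b _; rewrite Nr mulrC mulr_sumr.
  by apply: eq_bigr => i _; rewrite mulrA.
rewrite cochain_evalB cochain_eval_sum omE [X in X + _ - _](_ : _ =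
    \sum_l (coboundary (g (f l)) *~ inc v j (f l)) e); first by rewrite [X in X - _]addrC subrK subrr.
apply: eq_bigr => l _; rewrite cochain_evalMz ffunE -Nl -mulrzr intz N'l mulrC mulr_sumr.
by apply: eq_bigr => i _; rewrite mulrA.
Qed.

End Unimodular.

Lemma int_det_sq n (A B : 'M[int]_n) : A *m B = 1%:M -> \det B ^+ 2 = 1.
Proof.
move=> /(congr1 determinant); rewrite det_mulmx det1 => /intUnitRing.unitzPl.
by case/orP => /eqP ->.
Qed.

(** * Values of [theta] on dependent and on unimodular columns *)

Section Theta.
Variables (R : idomainType) (K : comNzRingType) (iota : {rmorphism R -> K}).
Variables (U : lmodType K) (E : finType) (p k : nat).
Variables (M : 'I_(p + k) -> E -> R) (u : 'I_(p + k) -> U) (f : 'I_p -> E).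

(** In the Leibniz expansion the last k rows force [i] to be the tail of the permutation. *)
Lemma theta_det : theta iota M u f
  = \sum_(i : {ffun 'I_k -> 'I_(p + k)}) iota (\det (\matrix_(a, j)
       match split a with inl l => M j (f l) | inr b => (i b == j)%:R end))
      *: wedge [ffun b => u (i b)].
Proof.
under [RHS]eq_bigr do rewrite /determinant rmorph_sum scaler_suml.
rewrite exchange_big; apply: eq_bigr => s _ /=.
rewrite (bigD1 (perm_tail s)) //= [X in _ + X]big1 ?addr0 => [|i /eqP si]; last first.
  have [b ib] : exists b, i b != s (rshift p b).
    apply/existsP; rewrite -negb_forall; apply/negP => /forallP h.
    by apply: si; apply/ffunP => b; rewrite ffunE; apply/eqP.
  rewrite (bigD1 (rshift p b)) //= mxE (unsplitK (inr b)) (negPf ib).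
  by rewrite mul0r mulr0 rmorph0 scale0r.
rewrite /wedge_tail; congr (iota (_ * _) *: wedge _); last first.
  by apply/ffunP => b; rewrite !ffunE.
rewrite big_split_ord /= [X in _ * X]big1 ?mulr1 => [|b _]; last first.
  by rewrite mxE (unsplitK (inr b)) ffunE eqxx.
by apply: eq_bigr => l _; rewrite mxE (unsplitK (inl l)).
Qed.

(** Extended by zeros, the relation [c] is a left kernel vector of every matrix in [theta_det]. *)
Lemma theta_dependent (c : 'I_p -> R) l0 : c l0 != 0 ->
  (forall j, \sum_l c l * M j (f l) = 0) -> theta iota M u f = 0.
Proof.
move=> c0 cM; rewrite theta_det big1 // => i _.
suff -> : \det (\matrix_(a, j) match split a with
    inl l => M j (f l) | inr b => (i b == j)%:R end) = 0 :> R by rewrite rmorph0 scale0r.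
apply/eqP/det0P; exists (\row_a match split a with inl l => c l | inr _ => 0 end).
  apply/eqP => /rowP/(_ (lshift k l0)); rewrite !mxE (unsplitK (inl l0)).
  exact/eqP.
apply/rowP => j; rewrite !mxE big_split_ord /= [X in _ + X]big1 ?addr0 => [|b _].
  rewrite -[RHS](cM j); apply: eq_bigr => l _.
  by rewrite !mxE (unsplitK (inl l)).
by rewrite !mxE (unsplitK (inr b)) mul0r.
Qed.

(** Jacobi's identity at the identity permutation, with [L] the transpose of [N'] and [us] the
    family with coordinates [N]; the hypothesis on [N' *m N] says that [L] carries [us] to [u]. *)
Lemma theta_unimodular (N N' : 'M[int]_(p + k)) : N' *m N = 1%:M ->
  (forall j l, M j (f l) = (N' j (lshift k l))%:~R) ->
  theta iota M u f = iota ((k`!)%:R * (\det N')%:~R) *: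
    wedge [ffun b => \sum_j (N (rshift p b) j)%:~R *: u j].
Proof.
move=> NN MN.
pose us i := \sum_j (N i j)%:~R *: u j.
pose L : 'M[K]_(p + k) := \matrix_(i, j) (N' j i)%:~R.
have uE j : u j = \sum_i L i j *: us i.
  rewrite /us; under eq_bigr do rewrite scaler_sumr.
  rewrite exchange_big /= (bigD1 j) //= [X in _ + X]big1 ?addr0 => [|i ij].
    under eq_bigr do rewrite scalerA mxE -intrM; rewrite -scaler_suml -rmorph_sum /=.
    have /matrixP/(_ j j) := NN; rewrite !mxE eqxx => ->.
    by rewrite scale1r.
  under eq_bigr do rewrite scalerA mxE -intrM; rewrite -scaler_suml -rmorph_sum /=.
  have /matrixP/(_ j i) := NN; rewrite !mxE eq_sym (negPf ij) => ->.
  by rewrite scale0r.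
have := @jacobi_tail K p k U L u us 1%g uE.
have -> : \det L = (\det N')%:~R.
  by rewrite -det_tr -(det_map_mx intr); congr determinant; apply/matrixP => i j; rewrite !mxE.
rewrite odd_perm1 expr0 mulr1 => h.
rewrite rmorphM rmorph_nat rmorph_int.
have -> : [ffun b : 'I_k => \sum_j (N (rshift p b) j)%:~R *: u j]
    = [ffun b => us ((1%g : 'S_(p + k)) (rshift p b))].
  by apply/ffunP => b; rewrite !ffunE perm1.
rewrite -[RHS]h; apply: eq_bigr => s _; congr (_ *: _).
rewrite rmorphM rmorph_sign rmorph_prod; congr (_ * _); apply: eq_bigr => l _.
by rewrite MN rmorph_int mxE perm1.
Qed.

End Theta.

(** * Forests as sets of positive edges *)

Section EdgeSets.
Variable G : graph.
Implicit Types (A F : {set edge G}).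

Definition sym_closure A := A :|: @einv G @: A.

Lemma sym_closure_subgraph A : subgraph (sym_closure A).
Proof.
apply/forall_inP => e; rewrite !inE => /orP[eA|/imsetP[f fA ->]].
  by rewrite imset_f ?orbT.
by rewrite einvK fA.
Qed.

Lemma sym_closure_pos A : A \subset pos G -> sym_closure A :&: pos G = A.
Proof.
move=> /subsetP Ap; apply/setP => e; rewrite !inE.
apply/andP/idP => [[/orP[//|/imsetP[f /Ap fp ->]]]|eA]; last by rewrite eA Ap.
by rewrite pos_einv fp.
Qed.

Lemma pos_sym_closure F : subgraph F -> sym_closure (F :&: pos G) = F.
Proof.
move=> sF; apply/setP => e; rewrite !inE.
have -> : (e \in @einv G @: (F :&: pos G)) = (e \in F) && (e \notin pos G).
  rewrite -{1}[e]einvK mem_imset; last exact: einvI.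
  by rewrite inE subgraph_einv// pos_einv.
by rewrite -andb_orr orbN andbT.
Qed.

(** A forest is determined by its positive edges, and by [forest_card] it has k+1 components exactly
    when there are p of these. *)
Lemma sum_forests (V : zmodType) p k (H : {set edge G} -> V) :
  #|vertex G| = (p + k).+1 ->
  \sum_(A : {set edge G} | (A \subset pos G) && (#|A| == p)%N)
     (if acyclic (sym_closure A) then H (sym_closure A) else 0)
  = \sum_(F in spanning_forests G k) H F.
Proof.
move=> cV; rewrite -big_mkcondr /=.
rewrite (reindex_onto (fun F => F :&: pos G) sym_closure) /= => [|A]; last first.
  by move=> /andP[/andP[Ap _] _]; apply: sym_closure_pos.
apply: eq_big => [F|F /andP[_ /eqP ->]//].
rewrite subsetIr inE /=; apply/andP/and3P => [[/andP[/eqP cp]]|[sF aF /eqP cF]].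
  move=> + /eqP FE; rewrite FE => aF.
  have sF : subgraph F by rewrite -FE; apply: sym_closure_subgraph.
  split=> //; have := forest_card sF aF; rewrite cp cV => /eqP.
  by rewrite -addnS eqn_add2l.
rewrite (pos_sym_closure sF) aF eqxx andbT; split=> //.
have /eqP := forest_card sF aF; rewrite cF cV -addnS eqn_add2r => ->.
by [].
Qed.

Lemma spanning_trees_forests : spanning_trees G = spanning_forests G 0.
Proof. by apply/setP => T; rewrite !inE. Qed.

(** A repeated edge gives two equal columns; otherwise a cycle gives the relation. *)
Lemma column_dependence p n (v : 'I_n -> vertex G) (f : {ffun 'I_p -> edge G}) :
  ~~ injectiveb f \/
    (f \in ffun_on (mem (pos G))) && ~~ acyclic (sym_closure [set f l | l in 'I_p]) ->
  exists (c : 'I_p -> int) l0, c l0 != 0 /\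
    forall j, \sum_l c l * inc v j (f l) = 0.
Proof.
have [/injectiveP fi [//|/andP[/ffun_onP fp nA]]|fi _] := boolP (injectiveb f).
  set A := [set f l | l in 'I_p] in nA.
  have Ap : A \subset pos G by apply/subsetP => _ /imsetP[l _ ->]; apply: fp.
  have [c [e]] := cyclic_dependence (sym_closure_subgraph A) nA.
  rewrite sym_closure_pos// => /imsetP[l0 _ ->] c0 cA.
  exists (c \o f), l0; split=> // j.
  have := cA (fun u => (u == v j)%:Z); rewrite big_imset /=; last by move=> ? ? _ _ /fi.
  by move=> h; rewrite -[RHS]h; apply: eq_bigl => l.
have /injectivePn[l [l' ll' fl]] := fi.
exists (fun l1 => (l1 == l)%:Z - (l1 == l')%:Z), l; split.
  by rewrite eqxx (negPf ll').
move=> j; under eq_bigr do rewrite mulrBl; rewrite sumrB.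
have d l1 : \sum_i (i == l1)%:Z * inc v j (f i) = inc v j (f l1).
  by rewrite (bigD1 l1) //= eqxx mul1r big1 ?addr0// => i /negPf->; apply: mul0r.
by rewrite !d fl subrr.
Qed.

End EdgeSets.

(** * The matrix-tree theorem *)

Section TreeDeterminant.
Variables (R : realType) (G : graph) (x : weights R G).

Lemma prod_weight p (f : {ffun 'I_p -> edge G}) : injectiveb f ->
  f \in ffun_on (mem (pos G)) ->
  weight_prod x (sym_closure [set f l | l in 'I_p]) = \prod_l x (f l).
Proof.
move=> /injectiveP fi /ffun_onP fp; rewrite /weight_prod.
set A := [set f l | l in 'I_p].
have Ap : A \subset pos G by apply/subsetP => _ /imsetP[l _ ->]; apply: fp.
have -> : sym_closure A :|: @einv G @: sym_closure A = sym_closure A.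
  apply/setUidPl/subsetP => _ /imsetP[e eA ->].
  by rewrite subgraph_einv//; apply: sym_closure_subgraph.
by rewrite sym_closure_pos// big_imset /=; [apply: eq_bigl | move=> ? ? _ _ /fi].
Qed.

Variables (n : nat) (r : vertex G) (v : 'I_n -> vertex G).
Hypotheses (rv : rooted r v) (cV : #|vertex G| = n.+1).

Definition incR (i : 'I_n) (e : edge G) : R := (inc v i e)%:~R.

(** Kirchhoff's theorem by Cauchy-Binet: the columns of a set containing a cycle are dependent, and
    those of a spanning tree have determinant 1 or -1. Both sides are compared after multiplication
    by n!, since the expansion runs over functions. *)
Lemma det_gram : \det (gram (pos G) x incR) = tree_sum x.
Proof.
suff : (\det (gram (pos G) x incR)) *+ n`! = tree_sum x *+ n`!.
  move/eqP; rewrite -subr_eq0 -mulrnBl mulrn_eq0 subr_eq0 eqn0Ngt fact_gt0 /=.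
  by move/eqP.
rewrite -sum_sq_det /tree_sum spanning_trees_forests.
rewrite -(@sum_forests G _ n 0); last by rewrite addn0.
have dep (f : {ffun 'I_n -> edge G}) : (exists (c : 'I_n -> int) l0, c l0 != 0 /\
    forall j, \sum_l c l * inc v j (f l) = 0) ->
    \det (\matrix_(i, l) incR i (f l)) = 0.
  move=> [c [l0 [c0 cE]]]; apply/eqP; rewrite -det_tr; apply/det0P.
  exists (\row_l (c l)%:~R).
    by apply: contraNneq c0 => /rowP/(_ l0)/eqP; rewrite !mxE intr_eq0.
  apply/rowP => j; rewrite !mxE; transitivity ((\sum_l c l * inc v j (f l))%:~R : R).
    by rewrite rmorph_sum; apply: eq_bigr => l _; rewrite !mxE -intrM.
  by rewrite cE.
apply: sum_ffun_image => f fi; first by rewrite dep ?expr0n ?mulr0//; apply: column_dependence; left.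
move=> fp; rewrite -prod_weight//; case: ifPn => [aF|nF]; last first.
  by rewrite dep ?expr0n ?mulr0//; apply: column_dependence; right; rewrite fp.
have [g gP] := forest_dual (sym_closure_subgraph _) aF.
have Ap : [set f l | l in 'I_n] \subset pos G.
  by move/ffun_onP: fp => fp; apply/subsetP => _ /imsetP[l _ ->]; apply: fp.
rewrite sym_closure_pos// in gP.
(* The functions dual to the tree edges, normalised at [r], give an integer left inverse of the
   incidence matrix of the tree. *)
pose Q := \matrix_(l, j) (g (f l) (v j) - g (f l) r).
pose D := \matrix_(j, l) inc v j (f l).
have QD : Q *m D = 1%:M.
  apply/matrixP => l l'; rewrite !mxE.
  transitivity (\sum_j (g (f l) (v j) - g (f l) r) *~ inc v j (f l')).
    by apply: eq_bigr => j _; rewrite !mxE -mulrzr intz.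
  rewrite (sum_inc_sub rv) gP ?imset_f// (inj_eq (injectiveP _ fi)) eq_sym.
  by case: (l == l').
have -> : \matrix_(i, l) incR i (f l) = map_mx intr D.
  by apply/matrixP => i l; rewrite !mxE.
by rewrite det_map_mx -rmorphXn /= (int_det_sq QD) mulr1.
Qed.

End TreeDeterminant.

(** * The orthogonal projection *)

Section Projection.
Variables (R : realType) (s : scalar_field) (G : graph) (x : weights R G).
Variables (n : nat) (r : vertex G) (v : 'I_n -> vertex G).
Hypotheses (rv : rooted r v) (cG : connected [set: edge G]).
Local Notation K := (scalars R s).
Local Notation Om := (Omega1 R s G).
Local Notation iota := (of_real (R:=R) s).

Definition vertex_form (i : 'I_n) : Om := differential (dirac R s (v i)).

Lemma vertex_formE i e : vertex_form i e = iota (incR R v i e).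
Proof.
by rewrite /incR rmorph_int !ffunE /inc rmorphB /=; do 2!case: (_ == _).
Qed.

Lemma Omega1_eq (a b : Om) : {in pos G, forall e, a e = b e} -> a = b.
Proof.
move=> ab; apply/val_inj/ffunP => e.
have [/ab//|ep] := boolP (e \in pos G).
have := ab (einv e); rewrite pos_einv ep => /(_ isT).
rewrite (antisymmetric_funP _ (cochainP a)) (antisymmetric_funP _ (cochainP b)).
exact: oppr_inj.
Qed.

Lemma Omega1_sumE (I : finType) (P : pred I) (c : I -> K) (b : I -> Om) e :
  (\sum_(i | P i) c i *: b i) e = \sum_(i | P i) c i * b i e.
Proof.
by rewrite [LHS]cochain_eval_sum; apply: eq_bigr => i _; rewrite !ffunE.
Qed.

Definition edge_form (e : edge G) : Om := of_int_cochain R s (estar e).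

Lemma edge_formE e f : e \in pos G -> f \in pos G -> edge_form e f = (f == e)%:R.
Proof.
move=> ep fp; rewrite !ffunE.
have -> : (f == einv e) = false; last by rewrite subr0.
by apply: contraTF ep => /eqP fe; rewrite fe pos_einv in fp.
Qed.

Lemma vertex_form_sum i :
  vertex_form i = \sum_(e in pos G) iota (incR R v i e) *: edge_form e.
Proof.
apply: Omega1_eq => f fp; rewrite Omega1_sumE (bigD1 f) //= edge_formE// eqxx mulr1.
rewrite big1 ?addr0 ?vertex_formE// => e /andP[ep ef].
by rewrite edge_formE// eq_sym (negPf ef) mulr0.
Qed.

Lemma inner_sumr (I : finType) (u : Om) (c : I -> K) (b : I -> Om) :
  inner x u (\sum_i c i *: b i) = \sum_i c i * inner x u (b i).
Proof.
apply: (big_ind2 (fun w a => inner x u w = a)).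
- exact: inner0r.
- by move=> w a w' a' <- <-; have := innerPr x 1 u w w'; rewrite scale1r mul1r.
- by move=> i _; have := innerPr x (c i) u (b i) 0; rewrite inner0r !addr0.
Qed.

Local Notation L := (gram (pos G) x (incR R v)).

Lemma inner_vertex_form i j : inner x (vertex_form i) (vertex_form j) = iota (L i j).
Proof.
rewrite mxE rmorph_sum; apply: eq_bigr => e _.
by rewrite !vertex_formE conjs_of_real !rmorphM mulrA.
Qed.

Lemma inner_vertex_edge i e : e \in pos G ->
  inner x (vertex_form i) (edge_form e) = iota (x e * incR R v i e).
Proof.
move=> ep; rewrite /inner (bigD1 e) //= big1 ?addr0 => [|f /andP[fp fe]].
  by rewrite edge_formE// eqxx mulr1 vertex_formE conjs_of_real -rmorphM.
by rewrite edge_formE// (negPf fe) !mulr0.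
Qed.

(** The quadratic form of L is a positively weighted sum of squares over the edges. A kernel vector
    makes every square vanish, so [inc_free] applies. *)
Lemma gram_unit : L \in unitmx.
Proof.
rewrite unitmxE unitfE; apply/negP => /det0P[c c0 cL].
have q : \sum_(e in pos G) x e * (\sum_i c 0 i * incR R v i e) ^+ 2 = 0.
  transitivity (\sum_j (c *m L) 0 j * c 0 j); last first.
    by rewrite cL big1 // => j _; rewrite mxE mul0r.
  transitivity (\sum_j \sum_i \sum_(e in pos G)
      x e * ((c 0 i * incR R v i e) * (c 0 j * incR R v j e))); last first.
    apply: eq_bigr => j _; rewrite mxE mulr_suml; apply: eq_bigr => i _.
    rewrite mxE mulr_sumr mulr_suml; apply: eq_bigr => e _.
    move: (c 0 i) (c 0 j) (incR R v i e) (incR R v j e) (x e) => a b a' b' y; ring.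
  under [RHS]eq_bigr do rewrite exchange_big /=.
  rewrite [RHS]exchange_big /=; apply: eq_bigr => e _.
  rewrite expr2 big_distrlr /= mulr_sumr [RHS]exchange_big /=.
  by apply: eq_bigr => i _; rewrite mulr_sumr.
have z e : e \in pos G -> \sum_i c 0 i * incR R v i e = 0.
  move/eqP: q; rewrite psumr_eq0 => [/allP h ep|f _]; last first.
    by rewrite mulr_ge0 ?sqr_ge0// ltW// weight_gt0.
  have := h e (mem_index_enum _); rewrite ep /= mulf_eq0 gt_eqF ?weight_gt0//=.
  by rewrite sqrf_eq0 => /eqP.
move/eqP: c0; apply; apply/rowP => i; rewrite mxE.
move: i; apply: (inc_free rv cG) => e.
under eq_bigr do rewrite -mulrzr.
have [/z//|ep] := boolP (e \in pos G).
apply: oppr_inj; rewrite oppr0.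
transitivity (\sum_i c 0 i * incR R v i (einv e)); last by rewrite z// pos_einv.
by rewrite -sumrN; apply: eq_bigr => i _; rewrite /incR inc_einv rmorphN mulrN.
Qed.

(** The basis of im d dual to the vertex forms for the inner product. *)
Definition dual_form (i : 'I_n) : Om := \sum_j iota (invmx L j i) *: vertex_form j.

Lemma vertex_form_dual j : vertex_form j = \sum_i iota (L i j) *: dual_form i.
Proof.
rewrite /dual_form; under eq_bigr do rewrite scaler_sumr.
rewrite exchange_big /=.
have e l : \sum_i iota (L i j) *: (iota (invmx L l i) *: vertex_form l)
    = iota ((1%:M : 'M[R]_n) l j) *: vertex_form l.
  rewrite -(mulVmx gram_unit) [in RHS]mxE rmorph_sum scaler_suml.
  by apply: eq_bigr => i _; rewrite scalerA -rmorphM mulrC.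
under eq_bigr do rewrite e.
rewrite (bigD1 j) //= mxE eqxx rmorph1 scale1r big1 ?addr0// => l lj.
by rewrite mxE (negPf lj) rmorph0 scale0r.
Qed.

Lemma inner_vertex_dual i j :
  inner x (vertex_form i) (dual_form j) = (i == j)%:R.
Proof.
have -> : (i == j)%:R = iota ((L *m invmx L) i j).
  by rewrite (mulmxV gram_unit) mxE rmorph_nat.
rewrite inner_sumr [in RHS]mxE rmorph_sum; apply: eq_bigr => l _.
by rewrite inner_vertex_form mulrC -rmorphM.
Qed.

Lemma closed_lin_sum (W : classical_sets.set Om) (I : finType) (c : I -> K) (b : I -> Om) :
  closed_lin W -> (forall i, W (b i)) -> W (\sum_i c i *: b i).
Proof.
move=> cW bW; apply: (big_ind W); first exact: cW.1.
- by move=> u w uW wW; rewrite -[u]scale1r; apply: cW.2.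
- by move=> i _; rewrite -[_ *: _]addr0; apply: cW.2 => //; apply: cW.1.
Qed.

Lemma differential_sum (f : {ffun vertex G -> K}) :
  differential f = \sum_i (f (v i) - f r) *: vertex_form i.
Proof.
apply/val_inj/ffunP => e; rewrite [RHS]Omega1_sumE ffunE -(sum_inc_sub rv).
by apply: eq_bigr => i _; rewrite vertex_formE /incR rmorph_int mulrzr.
Qed.

(** The coordinates of a projection in the dual basis are the inner products with the vertex forms.
    The real factor is kept outside, so that what remains is the left slot in [sum_tens_dual]. *)
Lemma proj_edge_form e : e \in pos G ->
  proj_im_d x (edge_form e) = iota (x e) *: \sum_j iota (incR R v j e) *: dual_form j.
Proof.
move=> ep.
have E : iota (x e) *: (\sum_j iota (incR R v j e) *: dual_form j)
    = \sum_j iota (x e * incR R v j e) *: dual_form j.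
  by rewrite scaler_sumr; apply: eq_bigr => j _; rewrite scalerA rmorphM.
rewrite E; apply: proj_im_d_unique => [|f].
  apply: closed_lin_sum; first exact: closed_im_d.
  move=> i; apply: closed_lin_sum; first exact: closed_im_d.
  by move=> j; exists (dirac R s (v j)).
set w := _ - _.
have vw i : inner x (vertex_form i) w = 0.
  rewrite innerBr inner_vertex_edge// inner_sumr (bigD1 i) //= inner_vertex_dual.
  rewrite eqxx mulr1 big1 ?addr0 ?subrr// => j ji.
  by rewrite inner_vertex_dual eq_sym (negPf ji) mulr0.
rewrite -innerC differential_sum inner_sumr big1 ?rmorph0// => i _.
by rewrite -innerC vw rmorph0 mulr0.
Qed.

End Projection.

(** * The two sides of the identity *)

Lemma ext_mapZ (K : comNzRingType) k (U V : lmodType K) (a : {linear U -> V}) c w :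
  ext_map (k := k) a (c *: w) = c *: ext_map a w.
Proof. exact: (linearZ_LR (ext_map (k := k) a)). Qed.

Lemma wedge_scaled_image (K : comNzRingType) k (U V : lmodType K)
    (a : {linear U -> V}) (c : 'I_k -> K) (w : 'I_k -> U) (w' : 'I_k -> V) :
  (forall b, w' b = c b *: a (w b)) ->
  wedge [ffun b => w' b] = (\prod_b c b) *: ext_map a (wedge [ffun b => w b]).
Proof.
move=> w'E; rewrite ext_map_wedge -wedge_scale; congr wedge.
by apply/ffunP => b; rewrite !ffunE.
Qed.

Section Sides.
Variables (R : realType) (s : scalar_field) (G : graph) (x : weights R G).
Local Notation K := (scalars R s).
Local Notation iota := (of_real (R:=R) s).
Local Notation tens := (tens iota).

Lemma weight_prod_sym_closure A : weight_prod x (sym_closure A) = weight_prod x A.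
Proof.
rewrite /weight_prod -/(sym_closure A) (_ : _ :|: _ = sym_closure A)//.
apply/setUidPl/subsetP => _ /imsetP[e eA ->].
by rewrite subgraph_einv//; apply: sym_closure_subgraph.
Qed.

(** The permutation sends a slot to the position of its edge in the sorted list; its sign cancels
    between the two tensor factors. *)
Lemma wedge_edge_forms k (f : {ffun 'I_k -> edge G}) : injective f ->
  exists t : 'S_k, wedge [ffun b => edge_form R s (f b)]
    = (-1) ^+ t *: estar_wedge R s k [set f b | b in 'I_k].
Proof.
move=> fi; set S := [set f b | b in 'I_k].
pose q := sort (@le_pos G) (enum S).
have sq : size q = k by rewrite size_sort -cardE card_imset ?card_ord.
have fq b : f b \in q by rewrite mem_sort mem_enum imset_f.
have tP b : (index (f b) q < k)%N by rewrite -[X in (_ < X)%N]sq index_mem.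
pose t b := Ordinal (tP b).
have ti : injective t.
  move=> b c /(congr1 val) /= bc; apply: fi.
  by rewrite -(nth_index (f b) (fq b)) bc nth_index.
exists (perm ti); rewrite /estar_wedge /wedge_basis -wedge_perm; congr wedge.
apply/ffunP => b; rewrite !ffunE permE /= (nth_map (f b)) ?index_mem//.
by rewrite nth_index.
Qed.

(** By [sum_tens_dual] the sum runs over edge tuples, each left slot being a projected edge form
    divided by its weight. The product of these inverse weights is shared equally by the two
    normalised factors. *)
Lemma sum_edge_sets n k (r : vertex G) (v : 'I_n -> vertex G) :
  rooted r v -> connected [set: edge G] ->
  \sum_(i : {ffun 'I_k -> 'I_n})
     tens (wedge [ffun b => dual_form s x v (i b)])
          (wedge [ffun b => vertex_form R s v (i b)])
  = (\sum_(S : {set edge G} | (S \subset pos G) && (#|S| == k)%N)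
      tens (ext_map (k := k) (proj_im_d (s := s) x) (estar_normalized s x k S))
           (estar_normalized s x k S)) *+ k`!.
Proof.
move=> rv cG.
rewrite (sum_tens_dual (iota := iota) k (dual_form s x v) (vertex_form_sum R s v)).
apply: sum_ffun_image => f fi; first by rewrite wedge_not_injective// tens0r.
move=> /ffun_onP fp; have [t tE] := wedge_edge_forms (injectiveP _ fi).
set W := estar_wedge _ _ _ _ in tE; set S := [set f b | b in 'I_k] in W tE *.
have Sp : S \subset pos G by apply/subsetP => _ /imsetP[b _ ->]; apply: fp.
rewrite [X in tens X _ = _](wedge_scaled_image (a := proj_im_d (s := s) x)
  (c := fun b => iota (x (f b))^-1) (w := fun b => edge_form R s (f b))); last first.
  move=> b; rewrite [X in _ *: X](proj_edge_form s x rv cG (fp b)) scalerA -rmorphM.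
  by rewrite mulVf ?rmorph1 ?scale1r// gt_eqF// weight_gt0.
rewrite -rmorph_prod tensZl.
rewrite tE ext_mapZ -(rmorph_sign iota) tensZl tensZr !scalerA -mulrA.
rewrite -signr_addb addbb mulr1 /estar_normalized -/W.
rewrite -fmorphV ext_mapZ tensZl tensZr scalerA; congr (_ *: _).
rewrite -invfM -expr2 sqr_sqrtr; last first.
  by apply: prodr_ge0 => e _; rewrite ltW// weight_gt0.
rewrite -weight_prod_sym_closure prod_weight//; last by apply/ffun_onP.
by rewrite prodfV.
Qed.

(** The coefficient of [th] on the wedge of [B] is k! times an integer determinant equal to 1 or -1,
    whose sign disappears in the tensor square. *)
Lemma tens_theta_forest p k (r : vertex G) (v : 'I_(p + k) -> vertex G)
    (f : {ffun 'I_p -> edge G}) (F := sym_closure [set f l | l in 'I_p])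
    (B : {ffun 'I_k -> int_cochain G}) :
  rooted r v -> connected [set: edge G] ->
  injective f -> f \in ffun_on (mem (pos G)) -> acyclic F -> Zbasis (B1_rel F) B ->
  let th := theta iota (incR R v) (vertex_form R s v) f in
  tens th th
  = ((k`!)%:R ^+ 2) *: tens (wedge_basis R s B) (wedge_basis R s B).
Proof.
move=> rv cG fi /ffun_onP fp aF BF th.
have fA : [set f l | l in 'I_p] = F :&: pos G.
  by rewrite sym_closure_pos//; apply/subsetP => _ /imsetP[l _ ->]; apply: fp.
have [N [N' [NN N'l NB]]] :=
  forest_unimodular rv cG fi fA (sym_closure_subgraph _) aF BF.
have -> : th = iota ((k`!)%:R * (\det N')%:~R) *: wedge_basis R s B.
  rewrite /th (theta_unimodular _ _ NN) => [|j l]; last by rewrite /incR N'l.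
  congr (_ *: wedge _); apply/ffunP => b; rewrite !ffunE.
  apply/val_inj/ffunP => e; rewrite [LHS]Omega1_sumE ffunE NB rmorph_sum.
  by apply: eq_bigr => j _; rewrite vertex_formE /incR rmorph_int rmorphM.
rewrite tensZl tensZr scalerA; congr (_ *: _); rewrite -expr2 exprMn.
by rewrite -[(\det N')%:~R ^+ 2]rmorphXn /= (int_det_sq (mulmx1C NN)) mulr1.
Qed.

Lemma sum_forest_bases p k (r : vertex G) (v : 'I_(p + k) -> vertex G)
    (B : {set edge G} -> {ffun 'I_k -> int_cochain G}) :
  rooted r v -> #|vertex G| = (p + k).+1 -> connected [set: edge G] ->
  (forall F, F \in spanning_forests G k -> Zbasis (B1_rel F) (B F)) ->
  (\sum_(f : {ffun 'I_p -> edge G} | f \in ffun_on (mem (pos G)))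
     (\prod_l x (f l)) *: tens (theta iota (incR R v) (vertex_form R s v) f)
                            (theta iota (incR R v) (vertex_form R s v) f))
  = ((k`!)%:R ^+ 2 *: \sum_(F in spanning_forests G k)
     weight_prod x F *: tens (wedge_basis R s (B F)) (wedge_basis R s (B F))) *+ p`!.
Proof.
move=> rv cV cG BP.
have BF (A : {set edge G}) : A \subset pos G -> #|A| = p -> acyclic (sym_closure A) ->
    Zbasis (B1_rel (sym_closure A)) (B (sym_closure A)).
  move=> Ap cA aA; apply: BP; rewrite inE aA sym_closure_subgraph /=.
  have := forest_card (sym_closure_subgraph A) aA.
  by rewrite sym_closure_pos// cA cV -addnS => /addnI/eqP.
rewrite -(sum_forests _ cV) scaler_sumr.
have dep (f : {ffun 'I_p -> edge G}) : (exists (c : 'I_p -> int) l0, c l0 != 0 /\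
    forall j, \sum_l c l * inc v j (f l) = 0) ->
    theta iota (incR R v) (vertex_form R s v) f = 0.
  move=> [c [l0 [c0 cE]]].
  apply: (@theta_dependent _ _ _ _ _ _ _ _ _ _ (fun l => (c l)%:~R) l0); first by rewrite intr_eq0.
  move=> j; transitivity ((\sum_l c l * inc v j (f l))%:~R : R); last by rewrite cE.
  by rewrite rmorph_sum; apply: eq_bigr => l _; rewrite -intrM.
apply: sum_ffun_image => f fi.
  by rewrite dep ?tens0l ?scaler0//; apply: column_dependence; left.
move=> fp; case: ifPn => [aF|nF]; last first.
  by rewrite dep ?tens0l ?scaler0//; apply: column_dependence; right; rewrite fp.
have Ap : [set f l | l in 'I_p] \subset pos G.
  by move/ffun_onP: fp => fp; apply/subsetP => _ /imsetP[l _ ->]; apply: fp.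
have cA : #|[set f l | l in 'I_p]| = p.
  by rewrite card_imset ?card_ord//; apply/injectiveP.
rewrite (tens_theta_forest rv cG (injectiveP _ fi) fp aF (BF _ Ap cA aF)).
by rewrite prod_weight// !scalerA mulrC.
Qed.

End Sides.

Theorem proposition7p2 (R : realType) (s : scalar_field) (G : graph)
    (x : weights R G) (k : nat)
    (B : {set edge G} -> {ffun 'I_k -> int_cochain G}) :
  connected [set: edge G] ->
  (forall F, F \in spanning_forests G k -> Zbasis (B1_rel F) (B F)) ->
  \sum_(F in spanning_forests G k)
     weight_prod x F *:
       tens (of_real s) (wedge_basis R s (B F)) (wedge_basis R s (B F))
  = tree_sum x *:
    \sum_(S : {set edge G} | (S \subset pos G) && (#|S| == k)%N)
      tens (of_real s)
        (ext_map (k := k) (proj_im_d (s := s) x) (estar_normalized s x k S))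
        (estar_normalized s x k S).
Proof.
move=> cG BP.
have [n cV] : exists n, #|vertex G| = n.+1.
  case cV : #|vertex G| => [|n]; last by exists n.
  have /eqP := cG; rewrite /components /n_comp_mem => c1.
  have := max_card (predI (roots (adj [set: edge G])) (mem predT)).
  by rewrite [#|vertex G|]cV c1.
have [r [v rv]] := rooted_ex cV.
have fact0 m : (m`!)%:R != 0 :> R by rewrite pnatr_eq0 -lt0n fact_gt0.
have SE := sum_edge_sets s x k rv cG.
(* For k > n no forest has k+1 components, and no k-tuple of the n vertex forms is injective, so by
   [SE] the right-hand sum vanishes as well. *)
have [kn|nk] := leqP k n; last first.
  rewrite big1 => [|F]; last first.
    rewrite inE => /and3P[sF aF /eqP cF]; have := forest_card sF aF.
    rewrite cF cV; lia.
  rewrite big1 in SE => [|i _]; last first.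
    rewrite wedge_not_injective ?tens0l//; apply/negP => /injectiveP/leq_card.
    by rewrite !card_ord leqNgt nk.
  move/esym/eqP: SE; rewrite -scaler_nat scaler_eq0 (negPf (fact0 k)) /= => /eqP->.
  by rewrite scaler0.
have [p np] : exists p, n = (p + k)%N by exists (n - k)%N; rewrite subnK.
subst n.
have := sum_tens_theta (p := p) (k := k) (vertex_form_dual s x rv cG).
rewrite (sum_forest_bases s x rv cV cG BP) SE (det_gram _ rv cV).
rewrite -!scaler_nat !scalerA => h.
(* Both sides carry the factor p! k!^2: on the left k!^2 comes from the square of [theta], on the
   right one k! comes from Jacobi's identity and one from the passage to edge sets. *)
apply: (scalerI (_ : (p`!)%:R * (k`!)%:R ^+ 2 != 0 :> R)).
  by rewrite mulf_neq0 ?expf_neq0.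
rewrite h scalerA; congr (_ *: _).
move: (tree_sum x) ((p`!)%:R) ((k`!)%:R) => a b c; ring.
Qed.
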